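(* Let $H=\Gamma_1(2+i)\le G=\mathrm{PSL}_2(\mathbf Z[i])$, $w=(1+i)/2$, and $$a=\begin{pmatrix}1&i\\0&1\end{pmatrix},\quad b=\begin{pmatrix}1&-1\\0&1\end{pmatrix},\quad c=\begin{pmatrix}-2i&i\\-2-i&1+i\end{pmatrix},\quad d=\begin{pmatrix}-1&1+i\\-1+2i&2-i\end{pmatrix}.$$ Then $a,b,c,d\in H$. There are exactly three $H$-orbits of unoriented Gaussian unimodular edges, represented with orientation by $e_1=[0,1]$, $e_2=[1,\infty]$, $e_3=[0,w]$, and exactly four $H$-orbits of Gaussian ideal triangles, represented with orientation by $f_A=(0,1,\infty)$, $f_B=(1,1+i,\infty)$, $f_E=(0,w,1)$, $f_F=(1,w,1+i)$. The setwise stabilizers in $H$ of all these edges and triangles are trivial. The boundaries are $$\begin{aligned}\partial_2f_A&=e_1+(1-b)e_2,&\partial_2f_B&=(a-1)e_2-d^{-1}e_3,\\ \partial_2f_E&=-(1+c^{-1}a)e_1+e_3,&\partial_2f_F&=c^{-1}a\,e_1+(c+d^{-1})e_3,\end{aligned}$$ so that, with rows indexed by $(e_1,e_2,e_3)$ and columns by $(f_A,f_B,f_E,f_F)$, the group-ring boundary matrix is $$M_{\partial_2}=\begin{pmatrix}1&0&-(1+c^{-1}a)&c^{-1}a\\1-b&a-1&0&0\\0&-d^{-1}&1&c+d^{-1}\end{pmatrix}\in M_{3\times4}(\mathbf Z[H]),$$ and, with $\partial_1e_1=[1]-[0]$, $\partial_1e_2=[\infty]-[1]$, $\partial_1e_3=[w]-[0]$,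 there is an exact sequence of left $\mathbf Z[H]$-modules $$\mathbf Z[H]^4\xrightarrow{M_{\partial_2}}\mathbf Z[H]^3\xrightarrow{\partial_1}\mathrm{St}_{\mathbf Q(i)}\longrightarrow0 .$$ Consequently, for every left $\mathbf Z[H]$-module $V$, $\mathrm{Symb}_H(V)=\mathrm{Hom}_{\mathbf Z[H]}(\mathrm{St}_{\mathbf Q(i)},V)=\ker\delta_H$, where $\delta_H:V^3\to V^4$ is $$\begin{aligned}(\delta_Hv)_A&=v_1+v_2-bv_2,&(\delta_Hv)_B&=av_2-v_2-d^{-1}v_3,\\(\delta_Hv)_E&=-v_1-c^{-1}av_1+v_3,&(\delta_Hv)_F&=c^{-1}av_1+cv_3+d^{-1}v_3 .\end{aligned}$$
   Context: $\Gamma_1(2+i)$ is the subgroup (of index $12$) of $\mathrm{PSL}_2(\mathbf Z[i])$ of elements whose reduction modulo $(2+i)$ lies in the image in $\mathrm{PSL}_2(\mathbf F_5)$ of the upper unipotent matrices, where $\mathbf Z[i]/(2+i)\cong\mathbf F_5$, $i\mapsto3$. Matrices denote their classes in $\mathrm{PSL}_2(\mathbf Z[i])$. $\mathrm{St}_{\mathbf Q(i)}$ is the rank-two Steinberg module, identified with $\ker(\mathbf Z[\mathbf P^1(\mathbf Q(i))]\xrightarrow{\deg}\mathbf Z)$. A Gaussian unimodular edge $[\alpha,\beta]$ is an ordered pair of cusps in $\mathbf P^1(\mathbf Q(i))$ having primitive lifts forming a basis of $\mathbf Z[i]^2$, with $[\beta,\alpha]=-[\alpha,\beta]$. A Gaussian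 ideal triangle is a triple of cusps spanned by $v_1,v_2,v_1+v_2$ with $(v_1,v_2)$ a basis of $\mathbf Z[i]^2$; orientation is a cyclic order, and reversal negates. The boundary maps are $\partial_1[\alpha,\beta]=[\beta]-[\alpha]$ and $\partial_2[\alpha,\beta,\gamma]=[\alpha,\beta]+[\beta,\gamma]+[\gamma,\alpha]$. Group elements act on the left; the $\mathbf Z[H]$-linear map $M_{\partial_2}$ sends the basis element for a triangle to the sum over its column entries, each entry acting on the left of the corresponding $e_r$; $\partial_1$ is extended $\mathbf Z[H]$-linearly. *)

(* Defs.v *)
From HB Require Import structures.
From mathcomp Require Import all_boot all_order all_algebra.
From mathcomp Require Import complex finmap.
From mathcomp.multinomials Require Import monalg.
From mathcomp Require Import boolp ring.

Set Implicit Arguments.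
Unset Strict Implicit.
Unset Printing Implicit Defensive.

Import GRing.Theory Num.Theory.

Local Open Scope fset_scope.
Local Open Scope quotient_scope.
Local Open Scope ring_scope.

Definition mx_of_rows (R : nmodType) (m n : nat) (s : seq (seq R)) :
  'M[R]_(m, n) := \matrix_(i, j) nth 0 (nth [::] s i) j.

Definition mx2 (R : nmodType) (x y z t : R) : 'M[R]_2 :=
  mx_of_rows 2 2 [:: [:: x; y]; [:: z; t]].

Definition cv2 (R : nmodType) (x y : R) : 'cV[R]_2 :=
  mx_of_rows 2 1 [:: [:: x]; [:: y]].

Lemma det_mx2 (R : comNzRingType) (x y z t : R) :
  \det (mx2 x y z t) = x * t - y * z.
Proof.
rewrite (expand_det_row _ 0) !big_ord_recl big_ord0 /cofactor !det_mx11 !mxE /=.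
by rewrite !(expr0, expr1, mul1r, mulN1r, addr0, mulrN).
Qed.

Section SL2.
Variable R : comNzRingType.

Definition SL2 := {A : 'M[R]_2 | \det A == 1}.
HB.instance Definition _ := Choice.on SL2.
HB.instance Definition _ := SubType.on SL2.

Lemma SL2_det (A : SL2) : \det (val A) = 1. Proof. exact/eqP/(valP A). Qed.

Fact sl2_one_subproof : \det (1%:M : 'M[R]_2) == 1.
Proof. by rewrite det1. Qed.
Fact sl2_mul_subproof (A B : SL2) : \det (val A *m val B) == 1.
Proof. by rewrite det_mulmx !SL2_det mulr1. Qed.
Fact sl2_inv_subproof (A : SL2) : \det (\adj (val A)) == 1.
Proof.
have := congr1 determinant (mul_mx_adj (val A)).
by rewrite det_mulmx SL2_det mul1r det1 => ->.
Qed.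

Definition sl2_one : SL2 := Sub 1%:M sl2_one_subproof.
Definition sl2_mul (A B : SL2) : SL2 := Sub (val A *m val B) (sl2_mul_subproof A B).
Definition sl2_inv (A : SL2) : SL2 := Sub (\adj (val A)) (sl2_inv_subproof A).

Fact sl2_mulA : associative sl2_mul.
Proof. by move=> A B C; apply/val_inj; rewrite /= mulmxA. Qed.
Fact sl2_mul1 : left_id sl2_one sl2_mul.
Proof. by move=> A; apply/val_inj; rewrite /= mul1mx. Qed.
Fact sl2_mulr1 : right_id sl2_one sl2_mul.
Proof. by move=> A; apply/val_inj; rewrite /= mulmx1. Qed.
Fact sl2_mulV : left_inverse sl2_one sl2_inv sl2_mul.
Proof. by move=> A; apply/val_inj; rewrite /= mul_adj_mx SL2_det. Qed.
Fact sl2_mulrV : right_inverse sl2_one sl2_inv sl2_mul.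
Proof. by move=> A; apply/val_inj; rewrite /= mul_mx_adj SL2_det. Qed.

HB.instance Definition _ :=
  isGroup.Build SL2 sl2_mulA sl2_mul1 sl2_mulr1 sl2_mulV sl2_mulrV.

Lemma val_sl2M (A B : SL2) : val (A * B)%g = val A *m val B. Proof. by []. Qed.
Lemma val_sl21 : val (1%g : SL2) = 1%:M. Proof. by []. Qed.

Definition psl2_equiv (A B : SL2) : bool :=
  (val A == val B) || (val A == - val B).

Fact psl2_equiv_refl : reflexive psl2_equiv.
Proof. by move=> A; rewrite /psl2_equiv eqxx. Qed.
Fact psl2_equiv_sym : symmetric psl2_equiv.
Proof.
by move=> A B; rewrite /psl2_equiv eq_sym; congr orb; rewrite -eqr_oppLR eq_sym.
Qed.
Fact psl2_equiv_trans : transitive psl2_equiv.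
Proof.
move=> B A C /orP[]/eqP AB /orP[]/eqP BC; rewrite /psl2_equiv AB BC ?opprK.
- by rewrite eqxx.
- by rewrite eqxx orbT.
- by rewrite eqxx orbT.
- by rewrite eqxx.
Qed.
Canonical psl2_equiv_equiv :=
  EquivRel psl2_equiv psl2_equiv_refl psl2_equiv_sym psl2_equiv_trans.

(* Over a domain, 1 and -1 are the only scalar matrices of determinant 1. *)
Definition PSL2 := {eq_quot psl2_equiv}.
HB.instance Definition _ := Choice.on PSL2.
HB.instance Definition _ := EqQuotient.on PSL2.

Definition psl2_class (A : SL2) : PSL2 := \pi_PSL2 A.

Lemma psl2_classP (A B : SL2) :
  reflect (val A = val B \/ val A = - val B) (psl2_class A == psl2_class B).
Proof.
rewrite /psl2_class piE /= /psl2_equiv.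
by apply: (iffP orP) => -[]/eqP; [left|right|left|right].
Qed.

Lemma psl2_reprK (x : PSL2) : psl2_class (repr x) = x.
Proof. exact: reprK. Qed.

Lemma psl2_repr_class (A : SL2) :
  val (repr (psl2_class A)) = val A \/ val (repr (psl2_class A)) = - val A.
Proof. by apply/psl2_classP/eqP; rewrite psl2_reprK. Qed.

Definition psl2_one : PSL2 := psl2_class 1%g.
Definition psl2_mul (x y : PSL2) : PSL2 := psl2_class (repr x * repr y)%g.
Definition psl2_inv (x : PSL2) : PSL2 := psl2_class (repr x)^-1%g.

Lemma psl2_classM (A B : SL2) :
  psl2_mul (psl2_class A) (psl2_class B) = psl2_class (A * B)%g.
Proof.
apply/eqP/psl2_classP; rewrite !val_sl2M.
case: (psl2_repr_class A) => ->; case: (psl2_repr_class B) => ->;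
  rewrite ?mulNmx ?mulmxN ?opprK; by [left|right].
Qed.

Fact psl2_mulA : associative psl2_mul.
Proof.
move=> x y z; rewrite -(psl2_reprK x) -(psl2_reprK y) -(psl2_reprK z).
by rewrite !psl2_classM mulgA.
Qed.
Fact psl2_mul1 : left_id psl2_one psl2_mul.
Proof. by move=> x; rewrite -(psl2_reprK x) psl2_classM mul1g. Qed.
Fact psl2_mulr1 : right_id psl2_one psl2_mul.
Proof. by move=> x; rewrite -(psl2_reprK x) psl2_classM mulg1. Qed.
Fact psl2_mulV : left_inverse psl2_one psl2_inv psl2_mul.
Proof. by move=> x; rewrite -{2}(psl2_reprK x) psl2_classM mulVg. Qed.
Fact psl2_mulrV : right_inverse psl2_one psl2_inv psl2_mul.
Proof. by move=> x; rewrite -{1}(psl2_reprK x) psl2_classM mulgV. Qed.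

HB.instance Definition _ :=
  isGroup.Build PSL2 psl2_mulA psl2_mul1 psl2_mulr1 psl2_mulV psl2_mulrV.

Lemma psl2_class_mul (A B : SL2) :
  psl2_class (A * B)%g = (psl2_class A * psl2_class B)%g.
Proof. by rewrite -psl2_classM. Qed.

Definition is_class_of (g : PSL2) (M : 'M[R]_2) : Prop :=
  exists A : SL2, val A = M /\ g = psl2_class A.

Fact unip_subproof (x : R) : \det (mx2 1 x 0 1) == 1.
Proof. by rewrite det_mx2 mulr0 mulr1 subr0. Qed.
Definition unip (x : R) : SL2 := Sub (mx2 1 x 0 1) (unip_subproof x).

End SL2.

Section Reduction.
Variables (R S : comNzRingType) (f : {rmorphism R -> S}).

Fact sl2_map_subproof (A : SL2 R) : \det (map_mx f (val A)) == 1.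
Proof. by rewrite det_map_mx SL2_det rmorph1. Qed.
Definition sl2_map (A : SL2 R) : SL2 S :=
  Sub (map_mx f (val A)) (sl2_map_subproof A).
Definition psl2_map (x : PSL2 R) : PSL2 S := psl2_class (sl2_map (repr x)).

Lemma psl2_map_class (A : SL2 R) :
  psl2_map (psl2_class A) = psl2_class (sl2_map A).
Proof.
apply/eqP/psl2_classP => /=.
by case: (psl2_repr_class A) => ->; rewrite ?map_mxN; [left|right].
Qed.

Lemma psl2_mapM (x y : PSL2 R) :
  psl2_map (x * y)%g = (psl2_map x * psl2_map y)%g.
Proof.
rewrite -(psl2_reprK x) -(psl2_reprK y) -psl2_class_mul !psl2_map_class.
rewrite -psl2_class_mul; congr psl2_class; apply/val_inj => /=.
exact: map_mxM.
Qed.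

Lemma psl2_map1 : psl2_map 1%g = 1%g.
Proof. by apply: (mulgI (psl2_map 1%g)); rewrite -psl2_mapM !mulg1. Qed.

Lemma psl2_mapV (x : PSL2 R) : psl2_map x^-1%g = (psl2_map x)^-1%g.
Proof.
by apply: (mulgI (psl2_map x)); rewrite -psl2_mapM !mulgV psl2_map1.
Qed.

End Reduction.

(* The library equips [R[i]] with a multiplication only when R is a field;
   the alias carries the ring structure given by the same formula [mulc]. *)
Definition Zi : Type := int[i]%C.
HB.instance Definition _ := GRing.Zmodule.on Zi.

Section ZiRing.
Local Open Scope complex_scope.
Fact Zi_mul1 : left_id (Complex 1 0 : Zi) (@ComplexField.mulc int).
Proof. by move=> [a b] /=; rewrite !mul1r !mul0r subr0 addr0. Qed.
Fact Zi_mulD : left_distributive (@ComplexField.mulc int : Zi -> Zi -> Zi) +%R.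
Proof.
by move=> [a b] [c d] [e f] /=; congr Complex; ring.
Qed.
Fact Zi_nonzero1 : (Complex 1 0 : Zi) != 0. Proof. by []. Qed.
End ZiRing.

HB.instance Definition _ := GRing.Zmodule_isComNzRing.Build Zi
  (@ComplexField.mulcA int) (@ComplexField.mulcC int)
  Zi_mul1 Zi_mulD Zi_nonzero1.

Definition zi : Zi := Complex 0 1.

Definition Qi := GRing.Field.clone rat[i]%C _.
Definition qi : Qi := Complex 0 1.

Definition Zi_to_Qi (z : Zi) : Qi :=
  @Complex rat (complex.Re z)%:~R (complex.Im z)%:~R.

Fact Zi_to_Qi_additive : zmod_morphism Zi_to_Qi.
Proof. by move=> [a b] [c d]; rewrite /Zi_to_Qi /= !rmorphB. Qed.
Fact Zi_to_Qi_multiplicative : monoid_morphism Zi_to_Qi.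
Proof.
split=> // -[a b] [c d]; rewrite /Zi_to_Qi /=.
by apply/eqP; rewrite eq_complex /= rmorphB rmorphD !rmorphM !eqxx.
Qed.
HB.instance Definition _ :=
  GRing.isZmodMorphism.Build Zi Qi Zi_to_Qi Zi_to_Qi_additive.
HB.instance Definition _ :=
  GRing.isMonoidMorphism.Build Zi Qi Zi_to_Qi Zi_to_Qi_multiplicative.

(* Z[i]/(2+i) = F_5 with i |-> 3. *)
Definition red5 (z : Zi) : 'F_5 :=
  (complex.Re z)%:~R + 3%:R * (complex.Im z)%:~R.

Fact red5_additive : zmod_morphism red5.
Proof.
move=> [a b] [c d]; rewrite /red5 /= !rmorphB /= mulrBr opprD !addrA.
by congr (_ + _); rewrite addrAC.
Qed.
Fact red5_multiplicative : monoid_morphism red5.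
Proof.
have i2 : 3%:R * 3%:R = -1 :> 'F_5 by apply/val_inj.
split=> [|[a b] [c d]]; first by rewrite /red5 /= mulr0 addr0.
rewrite /red5 /= rmorphB rmorphD !rmorphM /=.
set A : 'F_5 := a%:~R; set B : 'F_5 := b%:~R.
set C : 'F_5 := c%:~R; set D : 'F_5 := d%:~R.
rewrite -[- (B * D)]mulN1r -i2; ring.
Qed.
HB.instance Definition _ :=
  GRing.isZmodMorphism.Build Zi 'F_5 red5 red5_additive.
HB.instance Definition _ :=
  GRing.isMonoidMorphism.Build Zi 'F_5 red5 red5_multiplicative.

Definition gamma1_pred : {pred PSL2 Zi} :=
  fun g => [exists x : 'F_5, psl2_map red5 g == psl2_class (unip x)].

Fact gamma1_closed : group_closed gamma1_pred.
Proof.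
have unipM (x y : 'F_5) : (unip x * (unip y)^-1)%g = unip (x - y).
  apply: (mulIg (unip y)); rewrite -mulgA mulVg mulg1; apply/val_inj => /=.
  apply/matrixP => i j; rewrite !mxE !big_ord_recl big_ord0 !mxE.
  case: i => -[|[|//]] ?; case: j => -[|[|//]] ? /=;
    by rewrite !(mul1r, mul0r, mulr1, mulr0, addr0, add0r) ?subrKC // addrC subrK.
split=> [|x y /existsP[s /eqP xs] /existsP[t /eqP yt]].
  apply/existsP; exists 0; rewrite psl2_map1; apply/eqP; congr psl2_class.
  apply/val_inj/matrixP => i j; rewrite !mxE.
  by case: i => -[|[|//]] ?; case: j => -[|[|//]] ?.
apply/existsP; exists (s - t); rewrite psl2_mapM psl2_mapV xs yt -unipM.
rewrite psl2_class_mul; apply/eqP; congr (_ * _)%g.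
by apply: (mulgI (psl2_class (unip t))); rewrite mulgV -psl2_class_mul mulgV.
Qed.

Definition Gamma1 := {g : PSL2 Zi | gamma1_pred g}.
HB.instance Definition _ := Choice.on Gamma1.
HB.instance Definition _ := SubType.on Gamma1.
HB.instance Definition _ :=
  SubChoice_isSubGroup.Build (PSL2 Zi) gamma1_pred Gamma1 gamma1_closed.

Section FreeAbelian.
Variables (X : choiceType) (V : zmodType).
Implicit Types (f : X -> V) (m : {malg int[X]}).

(* The additive extension of [f] to the free abelian group on X. *)
Definition flift f m : V := \sum_(k <- msupp m) f k *~ m@_k.

Lemma fliftEw f m (D : {fset X}) :
  msupp m `<=` D -> flift f m = \sum_(k <- D) f k *~ m@_k.
Proof.
move=> sD; rewrite /flift (big_fset_incl _ sD) // => k _ km.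
by rewrite mcoeff_outdom // mulr0z.
Qed.

Fact flift_is_additive f : zmod_morphism (flift f).
Proof.
move=> m n; pose D := (msupp m `|` msupp n)%fset.
rewrite (@fliftEw f _ D) ?msuppB_le //.
rewrite (@fliftEw f m D) ?fsubsetUl // (@fliftEw f n D) ?fsubsetUr //.
by rewrite -sumrB; apply: eq_bigr => k _; rewrite mcoeffB mulrzBr.
Qed.
HB.instance Definition _ f :=
  GRing.isZmodMorphism.Build {malg int[X]} V (flift f) (flift_is_additive f).

Lemma fliftU f k : flift f << k >> = f k.
Proof. by rewrite /flift msuppU oner_eq0 big_seq_fset1 mcoeffUU. Qed.

Lemma eq_flift f g : f =1 g -> flift f =1 flift g.
Proof. by move=> fg m; apply: eq_bigr => k _; rewrite fg. Qed.

Lemma flift_funB f g m : flift (fun k => f k - g k) m = flift f m - flift g m.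
Proof. by rewrite -sumrB; apply: eq_bigr => k _; rewrite mulrzBl. Qed.

End FreeAbelian.

Lemma malg_Zind (X : choiceType) (P : {malg int[X]} -> Prop) :
  (forall k, P << k >>) -> (forall m n, P m -> P n -> P (m - n)) ->
  P 0 -> forall m, P m.
Proof.
move=> PU PB P0.
have PN m : P m -> P (- m) by move=> Pm; rewrite -sub0r; apply: PB.
have PD m n : P m -> P n -> P (m + n).
  by move=> Pm Pn; rewrite -[n]opprK; apply/PB/PN.
have Pn k n : P << n%:Z *g k >>.
  elim: n => [|n IH]; first by rewrite monalgU0.
  by rewrite intS monalgUD; apply: PD.
move=> m; rewrite [m]monalgE; apply: big_ind => // k _.
by case: (m@_k) => n; rewrite ?NegzE ?monalgUN; [|apply: PN]; apply: Pn.
Qed.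

Lemma flift_comp (X : choiceType) (V W : zmodType) (f : X -> V)
    (phi : {additive V -> W}) (m : {malg int[X]}) :
  phi (flift f m) = flift (phi \o f) m.
Proof.
elim/malg_Zind: m => [k|m n IHm IHn|]; first by rewrite !fliftU.
  by rewrite !raddfB IHm IHn.
by rewrite !raddf0.
Qed.

(* The biadditive extension of [op] to free abelian groups. *)
Definition flift2 (G X Y : choiceType) (op : G -> X -> Y)
    (x : {malg int[G]}) (m : {malg int[X]}) : {malg int[Y]} :=
  flift (fun g => flift (fun k => << op g k >>) m) x.

Section Flift2.
Variables (G X Y : choiceType) (op : G -> X -> Y).

Lemma flift2Bl x y m : flift2 op (x - y) m = flift2 op x m - flift2 op y m.
Proof. by rewrite /flift2 raddfB. Qed.
Lemma flift2Br x m n : flift2 op x (m - n) = flift2 op x m - flift2 op x n.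
Proof.
by rewrite /flift2 -flift_funB; apply: eq_flift => g; rewrite raddfB.
Qed.
Lemma flift20l m : flift2 op 0 m = 0. Proof. exact: raddf0. Qed.
Lemma flift20r x : flift2 op x 0 = 0.
Proof. by rewrite -[X in flift2 op x X](subrr 0) flift2Br subrr. Qed.
Lemma flift2Nl x m : flift2 op (- x) m = - flift2 op x m.
Proof. by rewrite -sub0r flift2Bl flift20l sub0r. Qed.
Lemma flift2Nr x m : flift2 op x (- m) = - flift2 op x m.
Proof. by rewrite -sub0r flift2Br flift20r sub0r. Qed.
Lemma flift2Dl x y m : flift2 op (x + y) m = flift2 op x m + flift2 op y m.
Proof. by rewrite -[y]opprK flift2Bl flift2Nl !opprK. Qed.
Lemma flift2Dr x m n : flift2 op x (m + n) = flift2 op x m + flift2 op x n.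
Proof. by rewrite -[n]opprK flift2Br flift2Nr !opprK. Qed.
Lemma flift2U g k : flift2 op << g >> << k >> = << op g k >>.
Proof. by rewrite /flift2 !fliftU. Qed.
End Flift2.

Lemma flift2A (G H K X Y Z : choiceType) (op1 : G -> H -> K) (op2 : K -> X -> Z)
    (op3 : H -> X -> Y) (op4 : G -> Y -> Z) :
  (forall g h k, op2 (op1 g h) k = op4 g (op3 h k)) ->
  forall x y m,
    flift2 op2 (flift2 op1 x y) m = flift2 op4 x (flift2 op3 y m).
Proof.
move=> opA x y m.
elim/malg_Zind: x => [g|x x' IH IH'|]; last by rewrite !flift20l.
  elim/malg_Zind: y => [h|y y' IH IH'|]; last by rewrite flift20r !flift20l flift20r.
    elim/malg_Zind: m => [k|m m' IH IH'|]; last by rewrite !flift20r.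
      by rewrite !flift2U opA.
    by rewrite !flift2Br IH IH'.
  by rewrite flift2Br !flift2Bl flift2Br IH IH'.
by rewrite !flift2Bl IH IH'.
Qed.

Lemma flift2_1 (G X : choiceType) (op : G -> X -> X) (e : G) :
  (forall k, op e k = k) -> forall m, flift2 op << e >> m = m.
Proof.
move=> op1 m; elim/malg_Zind: m => [k|m m' IH IH'|]; last by rewrite flift20r.
  by rewrite flift2U op1.
by rewrite flift2Br IH IH'.
Qed.

(* [{malg int[K]}] is a ring in the library only for monoids K without units,
   which excludes groups. *)
Definition groupRing (G : groupType) : Type := {malg int[G]}.
HB.instance Definition _ (G : groupType) := GRing.Zmodule.on (groupRing G).

Section GroupRing.
Variable G : groupType.

Definition gr_mul (x y : groupRing G) : groupRing G := flift2 (fun g h : G => (g * h)%g) x y.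
Definition gr_of (g : G) : groupRing G := << g >>.

Fact gr_mulA : associative gr_mul.
Proof. by move=> x y z; symmetry; apply: flift2A => g h k; rewrite mulgA. Qed.
Fact gr_mul1 : left_id (gr_of 1%g) gr_mul.
Proof. by move=> x; apply: flift2_1 => k; rewrite mul1g. Qed.
Fact gr_mulr1 : right_id (gr_of 1%g) gr_mul.
Proof.
move=> x; rewrite /gr_mul /gr_of.
elim/malg_Zind: x => [k|m m' IH IH'|]; last by rewrite flift20l.
  by rewrite flift2U mulg1.
by rewrite flift2Bl IH IH'.
Qed.
Fact gr_mulDl : left_distributive gr_mul +%R.
Proof. by move=> x y z; rewrite /gr_mul flift2Dl. Qed.
Fact gr_mulDr : right_distributive gr_mul +%R.
Proof. by move=> x y z; rewrite /gr_mul flift2Dr. Qed.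
Fact gr_nonzero1 : gr_of 1%g != 0.
Proof. by rewrite /gr_of monalgU_eq0 oner_eq0. Qed.

HB.instance Definition _ := GRing.Zmodule_isNzRing.Build (groupRing G)
  gr_mulA gr_mul1 gr_mulr1 gr_mulDl gr_mulDr gr_nonzero1.
End GroupRing.

HB.mixin Record isGSet (G : groupType) X of Choice X := {
  gact : G -> X -> X;
  gact1 : forall x, gact 1%g x = x;
  gactM : forall g h x, gact (g * h)%g x = gact g (gact h x)
}.
#[short(type="gSetType")]
HB.structure Definition GSet (G : groupType) := {X of isGSet G X & Choice X}.

Definition permMod (G : groupType) (X : gSetType G) : Type := {malg int[X]}.
HB.instance Definition _ (G : groupType) (X : gSetType G) :=
  GRing.Zmodule.on (permMod X).

Section PermMod.
Variables (G : groupType) (X : gSetType G).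

Definition pm_of (x : X) : permMod X := << x >>.
Definition pm_scale (a : groupRing G) (m : permMod X) : permMod X :=
  flift2 (@gact G X) a m.

Fact pm_scaleA a b m : pm_scale a (pm_scale b m) = pm_scale (a * b) m.
Proof.
rewrite /pm_scale; symmetry.
by apply: flift2A => g h k; rewrite gactM.
Qed.
Fact pm_scale1 : left_id 1 pm_scale.
Proof. by move=> m; apply: flift2_1 => k; rewrite gact1. Qed.
Fact pm_scaleDr : right_distributive pm_scale +%R.
Proof. by move=> a m n; rewrite /pm_scale flift2Dr. Qed.
Fact pm_scaleDl m : {morph pm_scale^~ m : a b / a + b}.
Proof. by move=> a b; rewrite /pm_scale flift2Dl. Qed.

HB.instance Definition _ := GRing.Zmodule_isLmodule.Build (groupRing G)
  (permMod X) pm_scaleA pm_scale1 pm_scaleDr pm_scaleDl.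

Lemma pm_scaleU (g : G) (x : X) : gr_of g *: pm_of x = pm_of (gact g x).
Proof. exact: flift2U. Qed.

Lemma flift_pm (V : zmodType) (f : X -> V) (x : X) : flift f (pm_of x) = f x.
Proof. exact: fliftU. Qed.

Definition degree (m : permMod X) : int := flift (fun=> 1) m.
HB.instance Definition _ := GRing.Additive.copy degree (flift (fun _ : X => 1)).

Lemma degreeB (m n : permMod X) : degree (m - n) = degree m - degree n.
Proof. exact: raddfB. Qed.
Lemma degreeD (m n : permMod X) : degree (m + n) = degree m + degree n.
Proof. exact: raddfD. Qed.
Lemma degreeU (x : X) : degree (pm_of x) = 1. Proof. exact: fliftU. Qed.

Lemma degreeZ (a : groupRing G) (m : permMod X) :
  degree (a *: m) = flift (fun=> 1) a * degree m.
Proof.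
rewrite -[a *: m]/(pm_scale a m) /pm_scale.
elim/malg_Zind: a => [g|a b IHa IHb|]; last by rewrite flift20l !raddf0 mul0r.
  rewrite fliftU mul1r; elim/malg_Zind: m => [k|m n IHm IHn|].
  - by rewrite flift2U !degreeU.
  - by rewrite flift2Br !degreeB IHm IHn.
  - by rewrite flift20r.
by rewrite flift2Bl degreeB IHa IHb raddfB mulrBl.
Qed.

Definition degree0 : {pred permMod X} := fun m => degree m == 0.
Fact degree0_closed : submod_closed degree0.
Proof.
split=> [|a m n]; first by rewrite unfold_in raddf0.
by rewrite !unfold_in degreeD degreeZ => /eqP-> /eqP->; rewrite mulr0.
Qed.

Fact degree0_diff (x y : X) : degree0 (pm_of y - pm_of x).
Proof. by rewrite /degree0 degreeB !degreeU subrr. Qed.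

Definition degKer := {m : permMod X | degree0 m}.
HB.instance Definition _ := Choice.on degKer.
HB.instance Definition _ := SubType.on degKer.
HB.instance Definition _ := GRing.SubChoice_isSubLmodule.Build
  (groupRing G) (permMod X) degree0 degKer degree0_closed.
End PermMod.

(* For a G-set X of oriented objects with an equivariant reversal [rev]: the
   quotient of Z[X] by the relations [rev x] = - [x]. *)
Section OrientedModule.
Variables (G : groupType) (X : gSetType G) (rev : X -> X).
Hypothesis rev_act : forall g x, rev (gact g x) = gact g (rev x).

Definition rev_sum (z : permMod X) : permMod X :=
  flift (fun x => pm_of x + pm_of (rev x)) z.

Lemma rev_sumB x y : rev_sum (x - y) = rev_sum x - rev_sum y.
Proof. exact: raddfB. Qed.
Lemma rev_sum0 : rev_sum 0 = 0.
Proof. exact: raddf0. Qed.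

Lemma rev_sumZ (a : groupRing G) z : rev_sum (a *: z) = a *: rev_sum z.
Proof.
elim/malg_Zind: a => [g|a b IHa IHb|]; last by rewrite !scale0r rev_sum0.
  elim/malg_Zind: z => [x|x y IHx IHy|].
  - rewrite -[<< g >>]/(gr_of g) -[<< x >>]/(pm_of x) pm_scaleU.
    by rewrite /rev_sum !flift_pm scalerDr !pm_scaleU rev_act.
  - by rewrite scalerBr !rev_sumB IHx IHy scalerBr.
  - by rewrite scaler0 rev_sum0 scaler0.
by rewrite !scalerBl rev_sumB IHa IHb.
Qed.

Definition rev_rel of (forall g x, rev (gact g x) = gact g (rev x)) :
    {pred permMod X} :=
  fun x => `[< exists z, x = rev_sum z >].

Fact rev_rel_closed : zmod_closed (rev_rel rev_act).
Proof.
split=> [|x y /asboolP[u ->] /asboolP[v ->]]; apply/asboolP.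
  by exists 0; rewrite rev_sum0.
by exists (u - v); rewrite rev_sumB.
Qed.
HB.instance Definition _ :=
  GRing.isZmodClosed.Build (permMod X) (rev_rel rev_act) rev_rel_closed.

Lemma rev_relZ a x : x \in rev_rel rev_act -> a *: x \in rev_rel rev_act.
Proof.
by move=> /asboolP[z ->]; apply/asboolP; exists (a *: z); rewrite rev_sumZ.
Qed.

Definition orientedMod : Type := Quotient.quot (rev_rel rev_act).
HB.instance Definition _ := GRing.Zmodule.on orientedMod.

Definition om_pi (x : permMod X) : orientedMod :=
  \pi_(Quotient.quot (rev_rel rev_act)) x.
Definition om_repr (x : orientedMod) : permMod X :=
  repr (x : Quotient.quot (rev_rel rev_act)).

Lemma om_piD x y : om_pi (x + y) = om_pi x + om_pi y.
Proof. exact: raddfD. Qed.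
Lemma om_reprK x : om_pi (om_repr x) = x.
Proof. exact: reprK. Qed.
Lemma om_piP x y : reflect (om_pi x = om_pi y) (x - y \in rev_rel rev_act).
Proof. by rewrite Quotient.idealrBE; apply: eqP. Qed.

Definition om_scale (a : groupRing G) (x : orientedMod) : orientedMod :=
  om_pi (a *: om_repr x).
Lemma om_piZ a x : om_pi (a *: x) = om_scale a (om_pi x).
Proof.
by apply/om_piP; rewrite -scalerBr; apply/rev_relZ/om_piP; rewrite om_reprK.
Qed.

Fact om_scaleA a b x : om_scale a (om_scale b x) = om_scale (a * b) x.
Proof. by rewrite -(om_reprK x) -!om_piZ scalerA. Qed.
Fact om_scale1 : left_id 1 om_scale.
Proof. by move=> x; rewrite -(om_reprK x) -!om_piZ scale1r. Qed.
Fact om_scaleDr : right_distributive om_scale +%R.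
Proof.
move=> a x y; rewrite -(om_reprK x) -(om_reprK y) -om_piD.
by rewrite -!om_piZ scalerDr om_piD.
Qed.
Fact om_scaleDl x : {morph om_scale^~ x : a b / a + b}.
Proof.
by move=> a b; rewrite -(om_reprK x) -!om_piZ scalerDl om_piD.
Qed.
HB.instance Definition _ := GRing.Zmodule_isLmodule.Build (groupRing G)
  orientedMod om_scaleA om_scale1 om_scaleDr om_scaleDl.

Definition om_of (x : X) : orientedMod := om_pi (pm_of x).

Lemma om_of_act g x : om_of (gact g x) = gr_of g *: om_of x.
Proof. by rewrite /om_of -pm_scaleU om_piZ. Qed.
Lemma om_of_rev x : om_of (rev x) = - om_of x.
Proof.
apply/eqP; rewrite -addr_eq0 -om_piD; apply/eqP.
rewrite -[RHS](raddf0 \pi_(Quotient.quot (rev_rel rev_act))).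
apply/om_piP/asboolP; exists (pm_of x).
by rewrite subr0 /rev_sum flift_pm addrC.
Qed.
End OrientedModule.

(* P^1(Q(i)) is the set of lines of Q(i)^2; z in Q(i) is the line of (z, 1). *)
Definition cusp := {L : {vspace 'cV[Qi]_2} | \dim L == 1%N}.
HB.instance Definition _ := Choice.on cusp.
HB.instance Definition _ := SubType.on cusp.

Fact pt_subproof (z : Qi) : \dim <[cv2 z 1]>%VS == 1%N.
Proof.
rewrite dim_vline eqb1; apply/eqP => /matrixP/(_ 1 0).
by rewrite !mxE /= => /eqP; rewrite oner_eq0.
Qed.
Definition pt (z : Qi) : cusp := Sub <[cv2 z 1]>%VS (pt_subproof z).

Fact infty_subproof : \dim <[cv2 (1 : Qi) 0]>%VS == 1%N.
Proof.
rewrite dim_vline eqb1; apply/eqP => /matrixP/(_ 0 0).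
by rewrite !mxE /= => /eqP; rewrite oner_eq0.
Qed.
Definition infty : cusp := Sub <[cv2 (1 : Qi) 0]>%VS infty_subproof.

Definition is_lift (al : cusp) (v : 'cV[Zi]_2) : Prop :=
  val al = <[map_mx Zi_to_Qi v]>%VS.

Lemma cusp_line (al : cusp) :
  exists2 v : 'cV[Qi]_2, v != 0 & val al = <[v]>%VS.
Proof.
have dal := valP al; exists (vpick (val al)).
  by rewrite vpick0 -dimv_eq0 (eqP dal).
apply/esym/eqP; rewrite eqEdim -memvE memv_pick (eqP dal) dim_vline.
by rewrite vpick0 -dimv_eq0 (eqP dal).
Qed.

Definition mulv (A : SL2 Zi) : 'cV[Qi]_2 -> 'cV[Qi]_2 :=
  mulmx (map_mx Zi_to_Qi (val A)).
HB.instance Definition _ A := GRing.Linear.on (mulv A).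

Definition line_image (A : SL2 Zi) (L : {vspace 'cV[Qi]_2}) :=
  (linfun (mulv A) @: L)%VS.

Lemma line_image1 A v : line_image A <[v]>%VS = <[mulv A v]>%VS.
Proof. by rewrite /line_image limg_line lfunE. Qed.

Lemma mulvM A B v : mulv (A * B)%g v = mulv A (mulv B v).
Proof. by rewrite /mulv val_sl2M map_mxM mulmxA. Qed.

Lemma mulv1 v : mulv 1%g v = v.
Proof. by rewrite /mulv val_sl21 map_mx1 mul1mx. Qed.

Lemma mulv_neq0 A v : v != 0 -> mulv A v != 0.
Proof.
apply: contraNneq => Av0.
by rewrite -[v]mulv1 -(mulVg A) mulvM Av0 raddf0.
Qed.

Fact cusp_act_subproof (A : SL2 Zi) (al : cusp) :
  \dim (line_image A (val al)) == 1%N.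
Proof.
have [v v0 ->] := cusp_line al.
by rewrite line_image1 dim_vline eqb1 mulv_neq0.
Qed.
Definition cusp_act (A : SL2 Zi) (al : cusp) : cusp :=
  Sub (line_image A (val al)) (cusp_act_subproof A al).

Lemma cusp_actM A B al : cusp_act (A * B)%g al = cusp_act A (cusp_act B al).
Proof.
apply/val_inj => /=; have [v _ ->] := cusp_line al.
by rewrite !line_image1 mulvM.
Qed.

Lemma cusp_act1 al : cusp_act 1%g al = al.
Proof.
apply/val_inj => /=; have [v _ ->] := cusp_line al.
by rewrite line_image1 mulv1.
Qed.

Lemma cusp_actN A B al : val A = - val B -> cusp_act A al = cusp_act B al.
Proof.
move=> AB; apply/val_inj => /=; have [v _ ->] := cusp_line al.
rewrite !line_image1 /mulv AB map_mxN mulNmx.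
by apply/eqP; rewrite eqEdim -memvE memvN memv_line !dim_vline oppr_eq0 leqnn.
Qed.

Definition psl2_act (g : PSL2 Zi) (al : cusp) : cusp := cusp_act (repr g) al.

Lemma psl2_act_class A al : psl2_act (psl2_class A) al = cusp_act A al.
Proof.
rewrite /psl2_act; case: (psl2_repr_class A) => [/val_inj->//|].
exact: cusp_actN.
Qed.

Fact psl2_act1 al : psl2_act 1%g al = al.
Proof. by rewrite psl2_act_class cusp_act1. Qed.
Fact psl2_actM g h al : psl2_act (g * h)%g al = psl2_act g (psl2_act h al).
Proof.
rewrite -(psl2_reprK g) -(psl2_reprK h) -psl2_class_mul.
by rewrite !psl2_act_class cusp_actM.
Qed.

Definition Gamma1_act (h : Gamma1) (al : cusp) : cusp := psl2_act (val h) al.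
Fact Gamma1_act1 al : Gamma1_act 1%g al = al.
Proof. exact: psl2_act1. Qed.
Fact Gamma1_actM g h al :
  Gamma1_act (g * h)%g al = Gamma1_act g (Gamma1_act h al).
Proof. exact: psl2_actM. Qed.
HB.instance Definition _ :=
  isGSet.Build Gamma1 cusp Gamma1_act1 Gamma1_actM.

Definition cuspSet := GSet.clone Gamma1 cusp _.

Definition ZH := GRing.NzRing.clone (groupRing Gamma1) _.

Definition St := GRing.Lmodule.clone ZH (degKer cuspSet) _.

Definition bd1 (e : cusp * cusp) : St :=
  Sub (pm_of e.2 - pm_of e.1) (degree0_diff e.1 e.2).

Definition primitive (v : 'cV[Zi]_2) : Prop :=
  exists s t : Zi, s * v 0 0 + t * v 1 0 = 1.

Definition is_basis (v w : 'cV[Zi]_2) : Prop :=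
  forall u : 'cV[Zi]_2, exists! c : Zi * Zi, u = c.1 *: v + c.2 *: w.

Definition unimodular (e : cusp * cusp) : Prop :=
  exists v w : 'cV[Zi]_2,
    [/\ primitive v, primitive w, is_lift e.1 v, is_lift e.2 w & is_basis v w].

(* Permuting the three cusps of a triangle gives again such a triple: replace
   (v, w) by (w, v) or by (- v, v + w). *)
Definition ideal_triangle (f : cusp * cusp * cusp) : Prop :=
  exists v w : 'cV[Zi]_2,
    [/\ is_basis v w, is_lift f.1.1 v, is_lift f.1.2 w & is_lift f.2 (v + w)].

Definition edge_set (e : cusp * cusp) : {fset cusp} := [fset e.1; e.2].
Definition triangle_set (f : cusp * cusp * cusp) : {fset cusp} :=
  [fset f.1.1; f.1.2; f.2].

Definition unoriented_edge (S : {fset cusp}) : Prop :=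
  exists e, unimodular e /\ S = edge_set e.
Definition unoriented_triangle (S : {fset cusp}) : Prop :=
  exists f, ideal_triangle f /\ S = triangle_set f.

Definition translate (h : Gamma1) (S : {fset cusp}) : {fset cusp} :=
  [fset gact h x | x in S].

(* There are exactly n orbits of Gamma1 in P, with representatives [rep i]:
   uniqueness of i makes the orbits of the [rep i] pairwise distinct. *)
Definition orbit_representatives (P : {fset cusp} -> Prop) (n : nat)
    (rep : 'I_n -> {fset cusp}) : Prop :=
  (forall i, P (rep i)) /\
  (forall S, P S -> exists! i, exists h : Gamma1, S = translate h (rep i)).

Definition trivial_stabilizers (P : {fset cusp} -> Prop) : Prop :=
  forall S, P S -> forall h : Gamma1, translate h S = S -> h = 1%g.

Definition oedge := {e : cusp * cusp | `[< unimodular e >]}.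
HB.instance Definition _ := Choice.on oedge.
HB.instance Definition _ := SubType.on oedge.

Lemma unimodular_rev e : unimodular e -> unimodular (e.2, e.1).
Proof.
move=> [v [w [pv pw lv lw vw]]]; exists w, v; split=> // u.
have [[x y] [/= uE uU]] := vw u; exists (y, x); split; first by rewrite addrC.
by move=> [x' y'] /=; rewrite addrC => /(uU (y', x')) [-> ->].
Qed.

Lemma unimodular_act (h : Gamma1) e :
  unimodular e -> unimodular (gact h e.1, gact h e.2).
Proof.
have prim (A : SL2 Zi) v : primitive v -> primitive (val A *m v).
  have ord1E : lift ord0 ord0 = 1 :> 'I_2 by apply/val_inj.
  have colE (u : 'cV[Zi]_2) : primitive u <-> exists r : 'rV_2, r *m u = 1%:M.
    split=> [[s [t st]]|[r /matrixP/(_ 0 0)]].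
      exists (\row_j nth 0 [:: s; t] j); apply/matrixP => i j.
      by rewrite !ord1 !mxE !big_ord_recl big_ord0 !mxE /= addr0 ord1E st.
    rewrite !mxE !big_ord_recl big_ord0 addr0 ord1E => ru.
    by exists (r 0 0), (r 0 1).
  move/colE => [r rv]; apply/colE; exists (r *m val A^-1%g).
  by rewrite mulmxA -(mulmxA r) -val_sl2M mulVg val_sl21 mulmx1.
have lift (A : SL2 Zi) al v : is_lift al v -> is_lift (cusp_act A al) (val A *m v).
  by move=> lv; rewrite /is_lift /= lv line_image1 /mulv map_mxM.
move=> [v [w [pv pw lv lw vw]]]; pose A := repr (val h).
exists (val A *m v), (val A *m w); split; try exact: prim; try exact: lift.
move=> u; have [c [uE uU]] := vw (val A^-1%g *m u); exists c; split.
  rewrite !scalemxAr -mulmxDr -uE mulmxA -val_sl2M mulgV val_sl21.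
  by rewrite mul1mx.
move=> c' uE'; apply: uU.
rewrite uE' mulmxDr -!scalemxAr !mulmxA -val_sl2M mulVg val_sl21.
by rewrite !mul1mx.
Qed.

Fact orev_subproof (e : oedge) : `[< unimodular ((val e).2, (val e).1) >].
Proof. exact/asboolP/unimodular_rev/asboolP/(valP e). Qed.
Definition orev (e : oedge) : oedge :=
  Sub ((val e).2, (val e).1) (orev_subproof e).

Fact oedge_act_subproof (h : Gamma1) (e : oedge) :
  `[< unimodular (gact h (val e).1, gact h (val e).2) >].
Proof. exact/asboolP/unimodular_act/asboolP/(valP e). Qed.
Definition oedge_act (h : Gamma1) (e : oedge) : oedge :=
  Sub (gact h (val e).1, gact h (val e).2) (oedge_act_subproof h e).
Fact oedge_act1 e : oedge_act 1%g e = e.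
Proof. by apply/val_inj; rewrite /= !gact1; case: (val e). Qed.
Fact oedge_actM g h e : oedge_act (g * h)%g e = oedge_act g (oedge_act h e).
Proof. by apply/val_inj; rewrite /= !gactM. Qed.
HB.instance Definition _ := isGSet.Build Gamma1 oedge oedge_act1 oedge_actM.

Lemma orev_act (h : Gamma1) (e : oedge) : orev (gact h e) = gact h (orev e).
Proof. exact/val_inj. Qed.

(* Z[oriented unimodular edges] modulo [beta, alpha] = - [alpha, beta]. *)
Definition edgeMod := GRing.Lmodule.clone ZH (orientedMod orev_act) _.

(* Zero, by convention, when [e] is not unimodular. *)
Definition edge_symbol (e : cusp * cusp) : edgeMod :=
  if insub e is Some o then om_of orev_act o else 0.

Definition bd2 (f : cusp * cusp * cusp) : edgeMod :=
  edge_symbol (f.1.1, f.1.2) + edge_symbol (f.1.2, f.2) +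
  edge_symbol (f.2, f.1.1).

Definition wpt : Qi := (1 + qi) / 2%:R.

Definition edge1 : cusp * cusp := (pt 0, pt 1).
Definition edge2 : cusp * cusp := (pt 1, infty).
Definition edge3 : cusp * cusp := (pt 0, pt wpt).
Definition edge_rep : 'I_3 -> cusp * cusp := tnth [tuple edge1; edge2; edge3].

Definition triA : cusp * cusp * cusp := (pt 0, pt 1, infty).
Definition triB : cusp * cusp * cusp := (pt 1, pt (1 + qi), infty).
Definition triE : cusp * cusp * cusp := (pt 0, pt wpt, pt 1).
Definition triF : cusp * cusp * cusp := (pt 1, pt wpt, pt (1 + qi)).
Definition tri_rep : 'I_4 -> cusp * cusp * cusp :=
  tnth [tuple triA; triB; triE; triF].

(* In coordinates on free left modules: the j-th basis element goes to the sum
   over i of M i j times the i-th basis element, so coefficients multiply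
   entries of M from the left. *)
Definition left_map (m n : nat) (M : 'M[ZH]_(m, n)) (x : 'rV[ZH]_n) : 'rV[ZH]_m :=
  x *m M^T.

Definition bd1_map (x : 'rV[ZH]_3) : St := \sum_r x 0 r *: bd1 (edge_rep r).

Definition Mbd2 (a b c d : Gamma1) : 'M[ZH]_(3, 4) :=
  mx_of_rows 3 4
    [:: [:: 1; 0; - (1 + gr_of (c^-1 * a)%g); gr_of (c^-1 * a)%g];
        [:: 1 - gr_of b; gr_of a - 1; 0; 0];
        [:: 0; - gr_of d^-1%g; 1; gr_of c + gr_of d^-1%g]].

Definition deltaH (a b c d : Gamma1) (V : lmodType ZH) (v : V * V * V) :
    V * V * V * V :=
  let: (v1, v2, v3) := v in
  (v1 + v2 - gr_of b *: v2,
   gr_of a *: v2 - v2 - gr_of d^-1%g *: v3,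
   - v1 - gr_of (c^-1 * a)%g *: v1 + v3,
   gr_of (c^-1 * a)%g *: v1 + gr_of c *: v3 + gr_of d^-1%g *: v3).

Definition Symb (V : lmodType ZH) := {linear St -> V}.

Definition symb_eval (V : lmodType ZH) (phi : Symb V) : V * V * V :=
  (phi (bd1 edge1), phi (bd1 edge2), phi (bd1 edge3)).

(* Main.v *)
Require Import Defs.
From HB Require Import structures.
From mathcomp Require Import all_boot all_order all_algebra.
From mathcomp Require Import complex finmap.
From mathcomp.multinomials Require Import monalg.
From mathcomp Require Import boolp zify ring.

Set Implicit Arguments.
Unset Strict Implicit.
Unset Printing Implicit Defensive.

Import Order.TTheory GRing.Theory Num.Theory.

Local Open Scope ring_scope.

(** Orbits and stabilizers are read off from bases of Z[i]^2.  An element of H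
    carries one basis to another as soon as the determinants agree and the
    second coordinates agree modulo 2+i up to a common sign ([transport]), so
    finding the orbit of an edge or of a triangle is a finite search over F_5
    ([edge_orbit], [tri_orbit]).  The orbits found are distinct because
    (y t / det)^2 in F_5, computed from lifts (x, y) and (z, t) of the ends of
    an edge, is an invariant of H ([edge_inv]) with values 1, 0, -1 on e_1,
    e_2, e_3; the values on the three sides separate the four triangles.
    Stabilizers are trivial because every element of H has trace 2 or -2
    modulo 2+i, whereas a matrix other than 1 and -1 that permutes the ends of
    an edge or the vertices of a triangle has trace 0 or a trace of square 1
    ([edge_stabilizers], [triangle_stabilizers]).

    The heart of the matter is exactness.  Dually it says that an antisymmetric
    function on edges whose sum around every ideal triangle vanishes is the
    coboundary of a function on cusps ([potentialP]).  This is the Euclidean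
    algorithm, with the path of divisions left free: measure a cusp by the norm
    of the denominator of a primitive lift and define the potential by
    descending along edges.  The neighbours of a cusp with lift v have lifts
    w + t v with t in Z[i], hence those of smaller depth correspond to the
    lattice points of an open disc of radius one.  Such a disc contains a
    lattice point, which is division with remainder, and its lattice points are
    connected by unit steps ([descending_connected]); two neighbours that
    differ by a unit step span an ideal triangle with the cusp, so the
    potential does not depend on the chosen descent.  An edge between cusps of
    equal depth is a side of a triangle whose third vertex is lower
    ([level_descends]).

    Since H acts freely on oriented edges, a triple v determines an equivariant
    antisymmetric function on edges with value v_r at e_r; its sums around the
    triangles f_A, f_B, f_E, f_F are the components of delta_H v, because the
    boundary formulas hold for any such function ([cycle_sum_rep]).  When they
    vanish, its potential is a modular symbol ([symbol_of_relations]).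
    Exactness at the middle term follows by taking for v the classes of the
    standard basis in the cokernel of the boundary matrix ([bd1_exact]), and
    exactness at the Steinberg module by the same descent
    ([bd1_map_surjective]). *)

(** * Norms and division of Gaussian integers *)

Definition normZ (z : Zi) : nat :=
  absz ((complex.Re z) ^+ 2 + (complex.Im z) ^+ 2).
Arguments normZ z%_R.

Lemma normZE a b : (normZ (Complex a b))%:Z = a ^+ 2 + b ^+ 2 :> int.
Proof. rewrite /normZ /=; nia. Qed.

Lemma normZM x y : normZ (x * y) = (normZ x * normZ y)%N.
Proof.
case: x y => a b [c d]; apply/eqP; rewrite -eqz_nat PoszM.
rewrite -[_ * _]/(Complex (a * c - b * d) (a * d + b * c)) !normZE; apply/eqP; ring.
Qed.

Lemma normZ_eq0 z : (normZ z == 0%N) = (z == 0).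
Proof.
case: z => a b; rewrite -eqz_nat normZE eq_complex /=.
apply/eqP/andP => [ab|[/eqP-> /eqP->]] //; split; apply/eqP; nia.
Qed.

Lemma normZ1 : normZ 1 = 1%N. Proof. by []. Qed.

Lemma Zi_mulf_eq0 (x y : Zi) : (x * y == 0) = (x == 0) || (y == 0).
Proof. by rewrite -!normZ_eq0 normZM muln_eq0. Qed.

Lemma Zi_mulfI (x : Zi) : x != 0 -> injective ( *%R x).
Proof.
move=> x0 y z /eqP; rewrite -subr_eq0 -mulrBr Zi_mulf_eq0 (negbTE x0) /=.
by rewrite subr_eq0 => /eqP.
Qed.

Definition Zi_units : seq Zi := [:: 1; zi; - 1; - zi].

Lemma normZ_units z : normZ z = 1%N -> z \in Zi_units.
Proof.
case: z => a b /eqP; rewrite -eqz_nat normZE => /eqP ab.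
rewrite !inE !eq_complex /=; nia.
Qed.

Lemma Zi_unitsP x : (exists y, x * y = 1) <-> x \in Zi_units.
Proof.
split=> [[y xy]|].
  apply: normZ_units; move: normZ1; rewrite -xy normZM => /eqP.
  by rewrite muln_eq1 => /andP[/eqP].
by rewrite !inE => /or4P[] /eqP->; [exists 1|exists (- zi)|exists (- 1)|exists zi].
Qed.

Lemma Zi_units_neq0 u : u \in Zi_units -> u != 0.
Proof. by rewrite !inE => /or4P[] /eqP->. Qed.

Lemma Zi_unitsN u : u \in Zi_units -> - u \in Zi_units.
Proof. by rewrite !inE => /or4P[] /eqP->. Qed.

Lemma int_round (a n : int) : 0 < n ->
  exists q : int, (2 * (a - q * n) <= n) /\ (- n <= 2 * (a - q * n)).
Proof.
move=> n0; exists ((2 * a + n) %/ (2 * n))%Z.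
have := divz_eq (2 * a + n) (2 * n); have := ltz_pmod (2 * a + n) (d := 2 * n).
have := modz_ge0 (2 * a + n) (d := 2 * n).
set q := (_ %/ _)%Z; set r := (_ %% _)%Z => h1 h2 e.
have {}h1 : 0 <= r by apply: h1; lia.
have {}h2 : r < 2 * n by apply: h2; lia.
nia.
Qed.

(** Round both coordinates of x / y to nearest integers: the remainder has norm
    at most half the norm of y. *)
Lemma Zi_divide (x y : Zi) : y != 0 -> exists q, (normZ (x - q * y) < normZ y)%N.
Proof.
case: x y => a b [c d] y0.
have n0 : 0 < c ^+ 2 + d ^+ 2 :> int.
  by rewrite -normZE; move: y0; rewrite -normZ_eq0; lia.
have [q [q1 q2]] := int_round (a * c + b * d) n0.
have [r [r1 r2]] := int_round (b * c - a * d) n0.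
exists (Complex q r).
have -> : (Complex a b : Zi) - (Complex q r : Zi) * (Complex c d : Zi) =
  Complex (a - (q * c - r * d)) (b - (q * d + r * c)) :> Zi by [].
rewrite -ltz_nat !normZE.
set s := a - _; set t := b - _; set n := c ^+ 2 + d ^+ 2 in n0 q1 q2 r1 r2 *.
(* X + i Y is the remainder x - (q + i r) y times the conjugate of y. *)
pose X := a * c + b * d - q * n; pose Y := b * c - a * d - r * n.
have XY : X ^+ 2 + Y ^+ 2 = n * (s ^+ 2 + t ^+ 2).
  rewrite /X /Y /n /s /t; ring.
rewrite -/X in q1 q2; rewrite -/Y in r1 r2.
move: (s ^+ 2 + t ^+ 2) XY => S; clearbody X Y n => XY.
have sq (Z : int) : 2 * Z <= n -> - n <= 2 * Z -> 4 * Z ^+ 2 <= n * n.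
  move=> z1 z2; rewrite -subr_ge0.
  have -> : n * n - 4 * Z ^+ 2 = (n - 2 * Z) * (n + 2 * Z) by ring.
  by apply: mulr_ge0; lia.
have {q1 q2}X2 := sq X q1 q2; have {r1 r2}Y2 := sq Y r1 r2.
rewrite ltNge; apply/negP => nS.
have nSS : n * n <= n * S by rewrite ler_pM2l.
have nn : 0 < n * n by rewrite mulr_gt0.
lia.
Qed.

(** * Gaussian integers in a disc *)

Lemma normZ_addM a b c d e f :
  (normZ ((Complex a b : Zi) + (Complex e f : Zi) * (Complex c d : Zi)))%:Z =
  (a + (e * c - f * d)) ^+ 2 + (b + (e * d + f * c)) ^+ 2.
Proof. exact: normZE. Qed.

Lemma normZ_parallelogram (x y : Zi) :
  (normZ (x + y) + normZ (x - y) = (normZ x + normZ y).*2)%N.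
Proof.
case: x y => a b [c d]; apply/eqP; rewrite -addnn -eqz_nat !PoszD.
have -> : (Complex a b : Zi) + (Complex c d : Zi) = Complex (a + c) (b + d) by [].
have -> : (Complex a b : Zi) - (Complex c d : Zi) = Complex (a - c) (b - d) by [].
by rewrite !normZE; apply/eqP; ring.
Qed.

(** The pairs of perpendicular units: the sides at the origin of the four unit
    squares meeting there. *)
Definition diagonals : seq (Zi * Zi) :=
  [:: (1, zi); (1, - zi); (- 1, zi); (- 1, - zi)].

(** The squared distances from the origin to opposite vertices of a square, here
    z, z + u1 y, z + (u1 + u2) y, z + u2 y, have the same sum. *)
Lemma normZ_square (z u1 u2 y : Zi) : (u1, u2) \in diagonals ->
  (normZ z + normZ (z + (u1 + u2) * y) =
   normZ (z + u1 * y) + normZ (z + u2 * y))%N.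
Proof.
case: z y => a b [c d] uv; apply/eqP; rewrite -eqz_nat !PoszD; apply/eqP.
by move: uv; rewrite !inE => /or4P[] /eqP[-> ->];
  rewrite !(normZ_addM, normZE); ring.
Qed.

(** The number 3 is not a sum of two squares, so norm less than 4 means 0, a unit,
    or the diagonal of a unit square. *)
Lemma normZ_lt4 t : (normZ t < 4)%N ->
  [\/ t = 0, t \in Zi_units |
      exists uv, uv \in diagonals /\ t = uv.1 + uv.2].
Proof.
case: t => a b; rewrite -ltz_nat normZE => ab.
have a1 : a \in [:: -1; 0; 1 : int] by rewrite !inE; nia.
have b1 : b \in [:: -1; 0; 1 : int] by rewrite !inE; nia.
move: a1 b1 ab; rewrite !inE => /or3P[] /eqP-> /or3P[] /eqP-> // _;
  first [by constructor 1 | by constructor 2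
        | by constructor 3; first
          [ by exists (1, zi) | by exists (1, -zi)
          | by exists (-1, zi) | by exists (-1, -zi)]].
Qed.

(** Divided by y, this is about lattice points in an open unit disc: two of them
    have distance less than 2, so they are equal, adjacent, or opposite vertices
    of a unit square, and in the last case one of the two other vertices is in
    the disc as well. *)
Lemma descending_connected (z y t : Zi) :
    (normZ z < normZ y)%N -> (normZ (z + t * y) < normZ y)%N ->
  [\/ t = 0, t \in Zi_units |
      exists u v, [/\ u \in Zi_units, v \in Zi_units, t = u + v &
                      (normZ (z + u * y) < normZ y)%N]].
Proof.
move=> zy zty.
have t4 : (normZ t < 4)%N.
  have := normZ_parallelogram (z + t * y) z.
  rewrite [_ + t * y - z]addrAC subrr add0r normZM.
  by move: (normZ t) (normZ y) zy zty => p q; nia.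
have [->|tu|[[u v] /= [uv tE]]] := normZ_lt4 t4; [by constructor 1|by constructor 2|].
constructor 3.
(* Both ends of the diagonal lie in the disc, so by this equality the two other
   vertices cannot both lie outside. *)
have := normZ_square z y uv; rewrite -tE => E.
have [uU vU] : u \in Zi_units /\ v \in Zi_units.
  by move: uv; rewrite !inE => /or4P[] /eqP[-> ->].
have [?|?] := ltnP (normZ (z + u * y)) (normZ y); first by exists u, v.
by exists v, u; split=> //; [rewrite addrC | lia].
Qed.

(** On the unit circle some unit direction makes an angle of at most 45 degrees
    with the direction of the centre, and a unit step along it leads into the
    open disc. *)
Lemma level_descends (z y : Zi) : y != 0 -> normZ z = normZ y ->
  exists u, u \in Zi_units /\ (normZ (z + u * y) < normZ y)%N.
Proof.
case: z y => a b [c d]; rewrite -normZ_eq0 => y0 E.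
have {y0} n0 : 0 < (normZ (Complex c d))%:Z by lia.
have {}E : (normZ (Complex a b))%:Z = normZ (Complex c d) by rewrite E.
(* p + i q is z times the conjugate of y. *)
pose p := a * c + b * d; pose q := b * c - a * d.
have pq : p ^+ 2 + q ^+ 2 = (normZ (Complex c d))%:Z ^+ 2.
  have -> : (normZ (Complex c d))%:Z ^+ 2 =
      (normZ (Complex a b))%:Z * (normZ (Complex c d))%:Z by rewrite E expr2.
  by rewrite !normZE /p /q; ring.
have NE e f (u := Complex e f : Zi) : u \in Zi_units ->
    (normZ ((Complex a b : Zi) + u * (Complex c d : Zi)))%:Z =
    2 * (normZ (Complex c d))%:Z + 2 * (e * p + f * q).
  move=> uU.
  have ef : e ^+ 2 + f ^+ 2 = 1 by move: uU; rewrite !inE => /or4P[] /eqP[-> ->].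
  rewrite normZ_addM.
  have -> : (a + (e * c - f * d)) ^+ 2 + (b + (e * d + f * c)) ^+ 2 =
    (a ^+ 2 + b ^+ 2) + (e ^+ 2 + f ^+ 2) * (c ^+ 2 + d ^+ 2) +
    2 * (e * p + f * q) by rewrite /p /q; ring.
  by rewrite ef mul1r -!normZE E; ring.
move: (NE 1 0) (NE 0 1) (NE (-1) 0) (NE 0 (-1)) => N1 N2 N3 N4.
have [hp|] := boolP ((normZ (Complex c d))%:Z < 2 * `|p|).
  case: (leP 0 p) => p0.
    by exists (-1); split=> //; rewrite -ltz_nat N3 //; lia.
  by exists 1; split=> //; rewrite -ltz_nat N1 //; lia.
rewrite -leNgt => hp.
have hq : (normZ (Complex c d))%:Z < 2 * `|q|.
  move: n0 pq hp; move: (Posz _) => n n0 pq hp.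
  rewrite ltNge; apply/negP => hq; clearbody p q.
  have p2 : `|p| * `|p| * 4 <= n * n by nia.
  have q2 : `|q| * `|q| * 4 <= n * n by nia.
  have : 0 < n * n by nia.
  nia.
case: (leP 0 q) => q0.
  by exists (- zi); split=> //; rewrite -ltz_nat N4 //; lia.
by exists zi; split=> //; rewrite -ltz_nat N2 //; lia.
Qed.

(** * Integral lifts of cusps *)

Section ColumnVectors.
Variable R : nzRingType.

Lemma cv2E (v : 'cV[R]_2) : v = cv2 (v 0 0) (v 1 0).
Proof.
apply/matrixP => i j; rewrite !mxE ord1.
case: i => -[|[|//]] p /=; congr (v _ _); exact/val_inj.
Qed.

Lemma cv2_inj (x y z t : R) : cv2 x y = cv2 z t -> x = z /\ y = t.
Proof.
by move=> /matrixP E; move: (E 0 0) (E 1 0); rewrite !mxE /=.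
Qed.

Lemma mulmx_cv2 (A : 'M[R]_2) x y :
  A *m cv2 x y = cv2 (A 0 0 * x + A 0 1 * y) (A 1 0 * x + A 1 1 * y).
Proof.
have E : lift ord0 ord0 = 1 :> 'I_2 by apply/val_inj.
rewrite [LHS]cv2E; congr cv2;
  by rewrite !mxE !big_ord_recl big_ord0 !mxE addr0 E.
Qed.

Lemma scale_cv2 (a x y : R) : a *: cv2 x y = cv2 (a * x) (a * y).
Proof. by rewrite [LHS]cv2E !mxE. Qed.

Lemma add_cv2 (x y z t : R) : cv2 x y + cv2 z t = cv2 (x + z) (y + t).
Proof. by rewrite [LHS]cv2E !mxE. Qed.

Lemma cv2_eq0 (x y : R) : (cv2 x y == 0) = (x == 0) && (y == 0).
Proof.
apply/eqP/andP => [E|[/eqP-> /eqP->]]; last by rewrite [RHS]cv2E !mxE.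
by apply/andP; move: E; rewrite [0]cv2E !mxE => /cv2_inj[-> ->]; rewrite eqxx.
Qed.

End ColumnVectors.

Lemma map_cv2 x y :
  map_mx Zi_to_Qi (cv2 x y) = cv2 (Zi_to_Qi x) (Zi_to_Qi y).
Proof. by rewrite [LHS]cv2E !mxE. Qed.

Lemma Zi_to_Qi_inj : injective Zi_to_Qi.
Proof.
move=> [a b] [c d] /eqP; rewrite eq_complex /= => /andP[].
by rewrite !eqr_int => /eqP-> /eqP->.
Qed.

(** Lifts are written in coordinates so that identities between them are
    polynomial identities in Z[i]. *)
Definition lifts (al : cusp) (x y : Zi) : Prop := is_lift al (cv2 x y).

Lemma liftsE al x y :
  lifts al x y <-> val al = <[cv2 (Zi_to_Qi x) (Zi_to_Qi y)]>%VS.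
Proof. by rewrite /lifts /is_lift map_cv2. Qed.

Lemma lifts_uniq al be x y : lifts al x y -> lifts be x y -> al = be.
Proof. by move=> lal lbe; apply/val_inj; rewrite lal lbe. Qed.

Lemma lifts_scale al x y u :
  u != 0 -> lifts al (u * x) (u * y) <-> lifts al x y.
Proof.
move=> u0; rewrite !liftsE !rmorphM -scale_cv2.
suff -> : <[Zi_to_Qi u *: cv2 (Zi_to_Qi x) (Zi_to_Qi y)]>%VS =
          <[cv2 (Zi_to_Qi x) (Zi_to_Qi y)]>%VS by [].
have v0 : Zi_to_Qi u != 0 by rewrite -(rmorph0 Zi_to_Qi) (inj_eq Zi_to_Qi_inj).
apply/eqP; rewrite eqEsubv -!memvE memvZ ?memv_line //.
by apply/vlineP; exists (Zi_to_Qi u)^-1; rewrite scalerA mulVf ?scale1r.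
Qed.

Lemma lifts_neq0 al x y : lifts al x y -> (x, y) <> (0, 0).
Proof.
move=> /liftsE lal [x0 y0]; have := valP al.
rewrite lal dim_vline x0 y0 rmorph0.
by rewrite cv2_eq0 eqxx.
Qed.

Lemma lifts_parallel al x y z t : lifts al x y -> lifts al z t -> x * t = y * z.
Proof.
move=> /liftsE lxy /liftsE lzt.
have : cv2 (Zi_to_Qi z) (Zi_to_Qi t) \in <[cv2 (Zi_to_Qi x) (Zi_to_Qi y)]>%VS.
  by rewrite -lxy lzt memv_line.
move=> /vlineP[k]; rewrite scale_cv2 => /cv2_inj[zE tE].
by apply: Zi_to_Qi_inj; rewrite !rmorphM /= zE tE; ring.
Qed.

Lemma lifts_act (h : Gamma1) (A : SL2 Zi) al x y :
  val h = psl2_class A -> lifts al x y ->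
  lifts (gact h al) (val A 0 0 * x + val A 0 1 * y)
                    (val A 1 0 * x + val A 1 1 * y).
Proof.
move=> hA lal; rewrite /lifts -mulmx_cv2 /is_lift.
rewrite -[gact h al]/(psl2_act (val h) al) hA psl2_act_class /=.
by rewrite lal line_image1 /mulv map_mxM.
Qed.

(** The product of the denominators of both coordinates clears them. *)
Lemma Qi_clear (p : Qi) : exists x d : Zi, d != 0 /\ Zi_to_Qi d * p = Zi_to_Qi x.
Proof.
case: p => a b.
exists (Complex (numq a * denq b) (numq b * denq a)), (Complex (denq a * denq b) 0).
split; first by rewrite eq_complex /= mulf_eq0 !(negbTE (denq_neq0 _)).
have num (r : rat) : (denq r)%:~R * r = (numq r)%:~R.
  by rewrite mulrC -[r in r * _]divq_num_den divfK // intr_eq0 denq_neq0.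
rewrite /Zi_to_Qi /=; apply/eqP; rewrite eq_complex /= !mul0r subr0 addr0 !rmorphM.
rewrite /= -!num; apply/andP; split; apply/eqP; ring.
Qed.

(** Primitivity of the vector (x, y). *)
Definition coprime2 (x y : Zi) : Prop := exists s t, s * x + t * y = 1.

Lemma Zi_bezout (x y : Zi) :
  exists d a b s t, [/\ x = d * a, y = d * b & s * a + t * b = 1].
Proof.
have [n] := ubnP (normZ y); elim: n x y => // n IH x y yn.
have [->|y0] := eqVneq y 0.
  by exists x, 1, 0, 1, 0; split; rewrite ?mulr1 ?mulr0 ?addr0.
have [q qy] := Zi_divide x y0.
have [d [a [b [s [t [yE rE st]]]]]] := IH y (x - q * y) (leq_trans qy yn).
exists d, (q * a + b), a, t, (s - t * q); split=> //.
  by rewrite mulrDr -rE yE; ring.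
by rewrite -st; ring.
Qed.

Lemma primitive_lift al :
  exists x y, lifts al x y /\ coprime2 x y.
Proof.
have [v v0 alE] := cusp_line al.
have [x [d [d0 dx]]] := Qi_clear (v 0 0); have [y [e [e0 ey]]] := Qi_clear (v 1 0).
have ld : lifts al (e * x) (d * y).
  apply/liftsE; rewrite alE !rmorphM /= -dx -ey.
  set D := Zi_to_Qi d; set E := Zi_to_Qi e.
  have [D0 E0] : D != 0 /\ E != 0.
    by split; rewrite -(rmorph0 Zi_to_Qi) (inj_eq Zi_to_Qi_inj).
  have -> : cv2 (E * (D * v 0 0)) (D * (E * v 1 0)) = (D * E) *: v.
    by rewrite [v in RHS]cv2E scale_cv2; congr cv2; ring.
  apply/eqP; rewrite eqEsubv -!memvE memvZ ?memv_line // andbT.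
  by apply/vlineP; exists (D * E)^-1; rewrite scalerA mulVf ?scale1r ?mulf_neq0.
have [k [a [b [s [t [xE yE st]]]]]] := Zi_bezout (e * x) (d * y).
exists a, b; split; last by exists s, t.
have k0 : k != 0.
  apply/eqP => k0; apply: (lifts_neq0 ld).
  by rewrite xE yE k0 !mul0r.
by apply/(lifts_scale _ _ _ k0); rewrite -xE -yE.
Qed.

(** Bezout coefficients for both vectors give the ratio u and its inverse. *)
Lemma primitive_unique al x y z t :
    lifts al x y -> coprime2 x y ->
    lifts al z t -> coprime2 z t ->
  exists2 u, u \in Zi_units & (z, t) = (u * x, u * y).
Proof.
move=> lx [s [p sp]] lz [s' [p' sp']].
have E := lifts_parallel lx lz; exists (s * z + p * t).
  apply/Zi_unitsP; exists (s' * x + p' * y).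
  have -> : (s * z + p * t) * (s' * x + p' * y) =
    (s * x + p * y) * (s' * z + p' * t) + (s * p' - p * s') * (y * z - x * t) by ring.
  by rewrite sp sp' E; ring.
congr pair; first rewrite -[LHS]mulr1 -sp; last rewrite -[LHS]mulr1 -sp.
  have -> : z * (s * x + p * y) = s * z * x + p * (y * z) by ring.
  by rewrite -E; ring.
have -> : t * (s * x + p * y) = s * (x * t) + p * t * y by ring.
by rewrite E; ring.
Qed.

(** In one direction the coordinates of the standard basis give the inverse of
    the determinant, in the other the coordinates are given by Cramer's rule. *)
Lemma basisP (x y z t : Zi) :
  is_basis (cv2 x y) (cv2 z t) <-> x * t - y * z \in Zi_units.
Proof.
rewrite -Zi_unitsP; split=> [bas|[D D1] u].
  have [[c1 c2] [/= + _]] := bas (cv2 1 0).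
  rewrite !scale_cv2 add_cv2 => /cv2_inj[c1E c2E].
  have [[d1 d2] [/= + _]] := bas (cv2 0 1).
  rewrite !scale_cv2 add_cv2 => /cv2_inj[d1E d2E].
  exists (c1 * d2 - c2 * d1).
  have -> : (x * t - y * z) * (c1 * d2 - c2 * d1) =
    (c1 * x + c2 * z) * (d1 * y + d2 * t) -
    (c1 * y + c2 * t) * (d1 * x + d2 * z) by ring.
  by rewrite -c1E -c2E -d1E -d2E; ring.
exists (D * (u 0 0 * t - u 1 0 * z), D * (x * u 1 0 - y * u 0 0)).
split=> [|[c1 c2]] /=; rewrite !scale_cv2 add_cv2.
  rewrite [u in LHS]cv2E -[u 0 0 in LHS]mul1r -[u 1 0 in LHS]mul1r -D1.
  by congr cv2; ring.
rewrite [u in u = _]cv2E => /cv2_inj[-> ->].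
have L c : c = (x * t - y * z) * D * c by rewrite D1 mul1r.
by rewrite [in RHS](L c1) [in RHS](L c2); congr pair; ring.
Qed.

Lemma det_primitive (x y z t : Zi) : x * t - y * z \in Zi_units ->
  coprime2 x y /\ coprime2 z t.
Proof.
move=> /Zi_unitsP[D D1]; split; [exists (D * t), (- D * z)|exists (- D * y), (D * x)];
  by rewrite -D1; ring.
Qed.

Lemma unimodularP al be : unimodular (al, be) <->
  exists x y z t, [/\ lifts al x y, lifts be z t & x * t - y * z \in Zi_units].
Proof.
split=> [[v [w [_ _ lv lw]]]|[x [y [z [t [lx lz D]]]]]].
  move: lv lw; rewrite [v]cv2E [w]cv2E /= => lv lw /basisP D.
  by exists (v 0 0), (v 1 0), (w 0 0), (w 1 0).
have [px pz] := det_primitive D.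
exists (cv2 x y), (cv2 z t); split=> //; last exact/basisP.
  by move: px => [s [p]]; exists s, p; rewrite !mxE.
by move: pz => [s [p]]; exists s, p; rewrite !mxE.
Qed.

Lemma idealP al be ga : ideal_triangle (al, be, ga) <->
  exists x y z t, [/\ lifts al x y, lifts be z t, lifts ga (x + z) (y + t) &
                      x * t - y * z \in Zi_units].
Proof.
split=> [[v [w [+ lv lw lvw]]]|[x [y [z [t [lx lz lxz D]]]]]].
  move: lv lw lvw; rewrite [v]cv2E [w]cv2E add_cv2 /= => lv lw lvw /basisP D.
  by exists (v 0 0), (v 1 0), (w 0 0), (w 1 0).
exists (cv2 x y), (cv2 z t); split=> //; first exact/basisP.
by rewrite add_cv2.
Qed.

(** * Depth and descent *)

Lemma lifts_exists (x y : Zi) :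
  coprime2 x y -> exists al, lifts al x y.
Proof.
move=> [s [t st]].
have d1 : \dim <[cv2 (Zi_to_Qi x) (Zi_to_Qi y)]>%VS == 1%N.
  rewrite dim_vline eqb1 cv2_eq0 -(rmorph0 Zi_to_Qi) !(inj_eq Zi_to_Qi_inj).
  apply/negP => /andP[/eqP x0 /eqP y0]; move/eqP: st.
  by rewrite x0 y0 !mulr0 addr0 eq_sym oner_eq0.
by exists (insubd infty <[cv2 (Zi_to_Qi x) (Zi_to_Qi y)]>%VS); apply/liftsE;
  rewrite val_insubd d1.
Qed.

(** The norm of the denominator of a cusp, 0 at infinity; see [depthE] for
    independence of the primitive lift. *)
Definition depth (al : cusp) : nat :=
  normZ (projT1 (cid (projT2 (cid (primitive_lift al))))).

Lemma depthE al x y :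
  lifts al x y -> coprime2 x y -> depth al = normZ y.
Proof.
move=> lx px; rewrite /depth; case: cid => x0 /= ex; case: cid => y0 /= [l0 p0].
have [u uU [_ ->]] := primitive_unique lx px l0 p0.
by move: uU; rewrite normZM !inE => /or4P[] /eqP->; rewrite mul1n.
Qed.

Notation adjacent al be := (unimodular (al, be)).

Lemma adjacent_sym al be : adjacent al be -> adjacent be al.
Proof. exact: unimodular_rev. Qed.

Lemma ideal_adjacent al be ga : ideal_triangle (al, be, ga) ->
  [/\ adjacent al be, adjacent be ga & adjacent ga al].
Proof.
move=> /idealP[x [y [z [t [lx lz lxz D]]]]].
split; apply/unimodularP.
- by exists x, y, z, t.
- exists z, t, (x + z), (y + t); split=> //.
  by have -> : z * (y + t) - t * (x + z) = - (x * t - y * z); [ring|apply: Zi_unitsN].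
- exists (x + z), (y + t), x, y; split=> //.
  by have -> : (x + z) * y - (y + t) * x = - (x * t - y * z); [ring|apply: Zi_unitsN].
Qed.

(** A determinant is a unit, and rescaling the second vector makes it 1; the
    lifts of the neighbours of a cusp then form a single coset of Z[i] (x, y). *)
Lemma adjacent_lift al be x y :
    lifts al x y -> coprime2 x y -> adjacent al be ->
  exists z t, lifts be z t /\ x * t - y * z = 1.
Proof.
move=> lx px /unimodularP[x' [y' [z [t [lx' lz D]]]]].
have [px' _] := det_primitive D.
have [u uU [xE yE]] := primitive_unique lx px lx' px'.
have : u * (x * t - y * z) \in Zi_units.
  by have -> : u * (x * t - y * z) = u * x * t - u * y * z; [ring|rewrite -xE -yE].
move=> /Zi_unitsP[v uv].
exists (u * v * z), (u * v * t); split.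
  apply/lifts_scale => //; apply: contra_eq_neq uv => uv.
  by rewrite mulrAC uv mul0r eq_sym oner_eq0.
by rewrite -uv; ring.
Qed.

Lemma adjacent_of_lifts al be x y z t :
  lifts al x y -> lifts be z t -> x * t - y * z = 1 -> adjacent al be.
Proof.
move=> lx lz D; apply/unimodularP; exists x, y, z, t; split=> //.
by rewrite D inE eqxx.
Qed.

(** Neighbours that differ by a unit step span a triangle with the cusp, since
    u (x, y) lifts the same cusp as (x, y). *)
Lemma ideal_of_lifts al be ga x y z t u :
    lifts al x y -> lifts be z t -> x * t - y * z = 1 ->
    u \in Zi_units -> lifts ga (z + u * x) (t + u * y) ->
  ideal_triangle (be, al, ga).
Proof.
move=> lx lz D uU lg; apply/idealP; exists z, t, (u * x), (u * y).
split=> //; first by apply/lifts_scale => //; apply: Zi_units_neq0.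
by have -> : z * (u * y) - t * (u * x) = - (u * (x * t - y * z)); 
  [ring | rewrite D mulr1 Zi_unitsN].
Qed.

Lemma depth_of_det al be x y z t :
    lifts al x y -> lifts be z t -> x * t - y * z = 1 ->
  depth al = normZ y /\ depth be = normZ t.
Proof.
move=> lx lz D; have DU : x * t - y * z \in Zi_units by rewrite D inE eqxx.
have [px pz] := det_primitive DU.
by rewrite (depthE lx px) (depthE lz pz).
Qed.

Lemma det_shift (x y z t u : Zi) : 
  x * t - y * z = 1 -> x * (t + u * y) - y * (z + u * x) = 1.
Proof. by move=> <-; ring. Qed.

Lemma lifts_shift al be x y z t u :
    lifts al x y -> lifts be z t -> x * t - y * z = 1 ->
  exists ga, lifts ga (z + u * x) (t + u * y).
Proof.
move=> lx lz D; apply: lifts_exists.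
have := det_shift u D; set z' := z + _; set t' := t + _ => D'.
by exists (- y), x; rewrite -D'; ring.
Qed.

(** Reducing the Bezout coefficient s modulo y gives a neighbour whose
    denominator is a remainder. *)
Lemma descending_neighbour al : depth al != 0%N ->
  exists be, adjacent be al /\ (depth be < depth al)%N.
Proof.
have [x [y [lx [s [p sp]]]]] := primitive_lift al.
rewrite (depthE lx); last by exists s, p.
rewrite normZ_eq0 => y0.
have [q qy] := Zi_divide s y0.
have D : x * (s - q * y) - y * (- p - q * x) = 1 by rewrite -sp; ring.
have [be lb] : exists be, lifts be (- p - q * x) (s - q * y).
  by apply: lifts_exists; exists (- y), x; rewrite -D; ring.
exists be; split; first exact/adjacent_sym/(adjacent_of_lifts lx lb).
by have [_ ->] := depth_of_det lx lb D.
Qed.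

(** The lifts of be and be' differ by a multiple k (x, y) of the lift of al, and
    depth only sees second coordinates, so [descending_connected] applies to k. *)
Lemma descending_neighbours_linked al be be' :
    adjacent be al -> adjacent be' al ->
    (depth be < depth al)%N -> (depth be' < depth al)%N ->
  [\/ be = be', ideal_triangle (be, al, be') |
      exists ga, [/\ (depth ga < depth al)%N, adjacent ga al,
                     ideal_triangle (be, al, ga) & ideal_triangle (ga, al, be')]].
Proof.
move=> /adjacent_sym ab /adjacent_sym ab'.
have [x [y [lx px]]] := primitive_lift al.
have [z [t [lz D]]] := adjacent_lift lx px ab.
have [z' [t' [lz' D']]] := adjacent_lift lx px ab'.
have [-> ->] := depth_of_det lx lz D; have [_ ->] := depth_of_det lx lz' D'.
(* k is the determinant of the two lifts; both have determinant 1 with (x, y). *)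
pose k := z' * t - t' * z.
have E c : c = (x * t - y * z) * c by rewrite D mul1r.
have E' c : c = (x * t' - y * z') * c by rewrite D' mul1r.
have zE : z' = z + k * x by rewrite [LHS]E [in RHS](E' z) /k; ring.
have tE : t' = t + k * y by rewrite [LHS]E [in RHS](E' t) /k; ring.
rewrite tE => ty t'y; rewrite zE tE in lz'.
have [k0|kU|[u [v [uU vU kE uy]]]] := descending_connected ty t'y.
- constructor 1; apply: (lifts_uniq lz); move: lz'.
  by rewrite k0 !mul0r !addr0.
- by constructor 2; apply: (ideal_of_lifts lx lz D kU).
- constructor 3; have [ga lg] := lifts_shift u lx lz D; exists ga.
  have Du := det_shift u D; split.
  + by have [_ ->] := depth_of_det lx lg Du.
  + exact/adjacent_sym/(adjacent_of_lifts lx lg).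
  + exact: (ideal_of_lifts lx lz D uU).
  + apply: (ideal_of_lifts lx lg Du vU).
    by move: lz'; rewrite kE !mulrDl !addrA.
Qed.

(** [level_descends], translated to cusps.  The denominator y is nonzero, for
    otherwise both ends of the edge would be infinity. *)
Lemma level_edge_below al be : adjacent al be -> depth be = depth al ->
  exists ga, (depth ga < depth al)%N /\ ideal_triangle (be, al, ga).
Proof.
move=> ab; have [x [y [lx px]]] := primitive_lift al.
have [z [t [lz D]]] := adjacent_lift lx px ab.
have [-> ->] := depth_of_det lx lz D => ty.
have y0 : y != 0.
  apply/eqP => y0; move: ty; rewrite y0 => /eqP; rewrite normZ_eq0 => /eqP t0.
  by move/eqP: D; rewrite y0 t0 mulr0 mul0r subr0 eq_sym oner_eq0.
have [u [uU uy]] := level_descends y0 ty.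
have [ga lg] := lifts_shift u lx lz D; exists ga.
have [_ ->] := depth_of_det lx lg (det_shift u D); split=> //.
exact: (ideal_of_lifts lx lz D uU).
Qed.

Definition descend (al : cusp) : cusp :=
  if pselect (exists be, adjacent be al /\ (depth be < depth al)%N) is left ex
  then projT1 (cid ex) else al.

Lemma descendP al : depth al != 0%N ->
  adjacent (descend al) al /\ (depth (descend al) < depth al)%N.
Proof.
by move=> /descending_neighbour ex; rewrite /descend; case: pselect => // ?; case: cid.
Qed.

Section Potential.
Variables (V : zmodType) (E : cusp -> cusp -> V).
Hypothesis E_anti : forall al be, adjacent al be -> E be al = - E al be.
Hypothesis E_tri : forall al be ga,
  ideal_triangle (al, be, ga) -> E al be + E be ga + E ga al = 0.

(** The sum of E along the path of chosen descents that ends at the cusp; n bounds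
    the number of steps, and the depth is such a bound. *)
Fixpoint path_sum n al : V :=
  if n is m.+1 then
    if depth al == 0%N then 0 else path_sum m (descend al) + E (descend al) al
  else 0.

Definition potential al := path_sum (depth al) al.

Lemma path_sum_fuel n m al : (depth al <= n)%N -> (depth al <= m)%N ->
  path_sum n al = path_sum m al.
Proof.
elim: n m al => [|n IH] [|m] al //=.
- by rewrite leqn0 => ->.
- by move=> _; rewrite leqn0 => ->.
case: eqVneq => // d0 an am; have [_ dl] := descendP d0.
by congr (_ + _); apply: IH; rewrite -ltnS; apply: leq_trans dl _.
Qed.

Lemma potentialE al : depth al != 0%N ->
  potential al = potential (descend al) + E (descend al) al.
Proof.
move=> d0; have [_ dl] := descendP d0.
rewrite /potential; case: (depth al) (d0) dl => // n _ dl /=.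
by rewrite (negbTE d0); congr (_ + _); apply: path_sum_fuel.
Qed.

(** Around a triangle the three differences and the three values of E both sum to
    zero: if they agree on one side, then they agree on both other sides or on
    neither. *)
Lemma potential_triangle al be ga : ideal_triangle (be, al, ga) ->
  potential ga - potential be = E be ga ->
  potential al - potential be = E be al <-> potential al - potential ga = E ga al.
Proof.
move=> T G; have [_ /adjacent_sym ga_al /adjacent_sym be_ga] := ideal_adjacent T.
have E_al : E be al = E ga al + E be ga.
  by apply/eqP; rewrite -subr_eq0 opprD addrA -(E_anti ga_al) -(E_anti be_ga) E_tri.
rewrite E_al -G -(subrKA (potential ga) (potential al)).
by split=> [/addIr|->].
Qed.

(** Induction on the larger depth of the ends.  For a descending edge, walk from
    the chosen descent to the given one through lower neighbours, one triangle at
    a time; the third side of each triangle is known by induction.  An edge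
    between equal depths is the third side of a triangle with two descending
    sides. *)
Theorem potentialP al be : adjacent al be -> potential be - potential al = E al be.
Proof.
have [n] := ubnP (maxn (depth al) (depth be)).
elim: n al be => // n IH.
have down al be : (depth al <= n)%N -> adjacent be al -> (depth be < depth al)%N ->
    potential al - potential be = E be al.
  move=> an ba lt; have d0 : depth al != 0%N by rewrite -lt0n; apply: leq_trans lt.
  have [da dlt] := descendP d0.
  have h0 : potential al - potential (descend al) = E (descend al) al.
    by rewrite potentialE // addrAC subrr add0r.
  have step b b' : (depth b < depth al)%N -> (depth b' < depth al)%N ->
      ideal_triangle (b, al, b') -> potential al - potential b = E b al ->
      potential al - potential b' = E b' al.
    move=> lb lb' T; have [_ _ /adjacent_sym bb'] := ideal_adjacent T.
    have G : potential b' - potential b = E b b'.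
      by apply: IH => //; rewrite gtn_max !(leq_trans _ an).
    by move/(potential_triangle T G).
  have [<-//|T|[ga [lg ga_al T T']]] := descending_neighbours_linked da ba dlt lt.
    exact: (step _ _ dlt lt T h0).
  exact: (step _ _ lg lt T' (step _ _ dlt lg T h0)).
move=> al be; rewrite ltnS geq_max => /andP[an bn] ab.
have [lt|lt|eq] := ltngtP (depth al) (depth be).
- exact: down.
- by rewrite (E_anti (adjacent_sym ab)) -(down al be) ?opprB //; apply: adjacent_sym.
have [ga [lg T]] := level_edge_below ab (esym eq).
have [ba ag gb] := ideal_adjacent T.
have G : potential ga - potential be = E be ga.
  by rewrite (E_anti gb) -(down be ga) ?opprB // -eq.
have /(potential_triangle T G) h : potential al - potential ga = E ga al.
  by apply: down => //; apply: adjacent_sym.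
by rewrite (E_anti ba) -h opprB.
Qed.
End Potential.

(** * Elements of the congruence subgroup *)

Lemma mx2_entries (R : nmodType) (M : 'M[R]_2) :
  M = mx2 (M 0 0) (M 0 1) (M 1 0) (M 1 1).
Proof.
apply/matrixP => i j; rewrite !mxE; case: i => -[|[|//]] p; case: j => -[|[|//]] q /=;
  congr (M _ _); exact/val_inj.
Qed.

Lemma SL2_entries (R : comNzRingType) (A : SL2 R) :
  val A 0 0 * val A 1 1 - val A 0 1 * val A 1 0 = 1.
Proof. by rewrite -det_mx2 -mx2_entries SL2_det. Qed.

Lemma sl2_exists (R : comNzRingType) (x y z t : R) :
  x * t - y * z = 1 -> exists A : SL2 R, val A = mx2 x y z t.
Proof.
move=> D; have d1 : \det (mx2 x y z t) == 1 by rewrite det_mx2 D.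
by exists (exist (fun A : 'M[R]_2 => \det A == 1) _ d1).
Qed.

Definition signs : seq 'F_5 := [:: 1; - 1].

Lemma signs_sqr e : e \in signs -> e * e = 1.
Proof. by rewrite !inE => /orP[] /eqP->; rewrite ?mulrNN mulr1. Qed.

Lemma gamma1_entries (A : SL2 Zi) : gamma1_pred (psl2_class A) ->
  exists e, [/\ e \in signs, red5 (val A 0 0) = e, red5 (val A 1 0) = 0 &
                red5 (val A 1 1) = e].
Proof.
case/existsP => x; rewrite psl2_map_class => /psl2_classP[] /= /matrixP E.
  exists 1; split=> //.
  - by have := E 0 0; rewrite !mxE.
  - by have := E 1 0; rewrite !mxE.
  - by have := E 1 1; rewrite !mxE.
exists (-1); split=> //.
- by have := E 0 0; rewrite !mxE.
- by have := E 1 0; rewrite !mxE /= oppr0.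
- by have := E 1 1; rewrite !mxE.
Qed.

Lemma gamma1_repr (h : Gamma1) : exists A e,
  [/\ val h = psl2_class A, e \in signs, red5 (val A 0 0) = e,
      red5 (val A 1 0) = 0 & red5 (val A 1 1) = e].
Proof.
have hA : val h = psl2_class (repr (val h)) by rewrite psl2_reprK.
have [|e [es A00 A10 A11]] := @gamma1_entries (repr (val h)).
  by rewrite -hA; apply: (valP h).
by exists (repr (val h)), e.
Qed.

(** The determinant forces the upper left entry to reduce to the same sign. *)
Lemma gamma1_intro (A : SL2 Zi) e : e \in signs -> red5 (val A 1 0) = 0 ->
  red5 (val A 1 1) = e -> gamma1_pred (psl2_class A).
Proof.
move=> es A10 A11; have ee := signs_sqr es.
have A00 : red5 (val A 0 0) = e.
  have := congr1 red5 (SL2_entries A).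
  rewrite rmorphB !rmorphM /= A10 A11 mulr0 subr0 rmorph1 => E.
  by rewrite -[LHS]mulr1 -ee mulrA E mul1r.
apply/existsP; exists (e * red5 (val A 0 1)); rewrite psl2_map_class.
have E : val (sl2_map red5 A) = mx2 e (red5 (val A 0 1)) 0 e.
  by rewrite [LHS]mx2_entries /= !mxE A00 A10 A11.
apply/psl2_classP; rewrite E /=.
move: es; rewrite !inE => /orP[] /eqP ->; [left; by rewrite mul1r|right].
by rewrite mulN1r [RHS]mx2_entries !mxE /= opprK oppr0.
Qed.

(** The matrix h = (v' w') (v w)^-1 is integral of determinant 1, and its second
    row reduces to (0, e): the row vector (y', t') is e (y, t) modulo 2+i, and
    (y, t) (v w)^-1 = (0, 1). *)
Lemma transport (x y z t x' y' z' t' : Zi) e :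
    x * t - y * z \in Zi_units -> x' * t' - y' * z' = x * t - y * z ->
    e \in signs -> red5 y' = e * red5 y -> red5 t' = e * red5 t ->
  exists h : Gamma1, forall p q al, lifts al (p * x + q * z) (p * y + q * t) ->
    lifts (gact h al) (p * x' + q * z') (p * y' + q * t').
Proof.
move=> /Zi_unitsP[D D1] D' es ye te.
pose a := D * (x' * t - z' * y); pose b := D * (z' * x - x' * z).
pose c := D * (y' * t - t' * y); pose d := D * (t' * x - y' * z).
have det1 : a * d - b * c = 1.
  have -> : a * d - b * c = (x * t - y * z) * D * ((x' * t' - y' * z') * D).
    by rewrite /a /b /c /d; ring.
  by rewrite D' D1 mulr1.
have [A AE] := sl2_exists det1.
have hA : gamma1_pred (psl2_class A).
  apply: (gamma1_intro es); rewrite AE !mxE /=.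
    by rewrite !(rmorphM, rmorphB) /= ye te; ring.
  rewrite !(rmorphM, rmorphB) /= ye te.
  have := congr1 red5 D1; rewrite !(rmorphM, rmorphB) rmorph1 /= => rD.
  by rewrite -[RHS]mulr1 -rD; ring.
pose h : Gamma1 := exist (fun g => gamma1_pred g) _ hA.
exists h => p q al /(lifts_act (h := h) erefl).
rewrite AE !mxE /=.
have E k : k = (x * t - y * z) * D * k by rewrite D1 mul1r.
congr (lifts _ _ _); rewrite [RHS]E /a /b /c /d; ring.
Qed.

Definition prim_lift (al : cusp) : Zi * Zi :=
  let: exist x ex := cid (primitive_lift al) in (x, projT1 (cid ex)).

Lemma prim_liftP al :
  lifts al (prim_lift al).1 (prim_lift al).2 /\
  coprime2 (prim_lift al).1 (prim_lift al).2.
Proof. by rewrite /prim_lift; case: cid => x ex /=; case: cid. Qed.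

(** Rescaling a lift by a unit multiplies y t and the determinant alike; the square
    removes the sign that comes from exchanging the ends. *)
Definition edge_value (x y z t : Zi) : 'F_5 :=
  (red5 y * red5 t / red5 (x * t - y * z)) ^+ 2.

(** Defined on all pairs of cusps; equal cusps get 0, as the inverse of 0 is 0. *)
Definition edge_inv (al be : cusp) : 'F_5 :=
  edge_value (prim_lift al).1 (prim_lift al).2 (prim_lift be).1 (prim_lift be).2.

Lemma red5_units u : u \in Zi_units -> red5 u != 0.
Proof. by rewrite !inE => /or4P[] /eqP->. Qed.

Lemma edge_invE al be x y z t :
  lifts al x y -> coprime2 x y -> lifts be z t -> coprime2 z t ->
  edge_inv al be = edge_value x y z t.
Proof.
move=> lx px lz pz; rewrite /edge_inv.
have [la pa] := prim_liftP al; have [lb pb] := prim_liftP be.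
move: (prim_lift al) (prim_lift be) la pa lb pb => [a a'] [b b'] /= la pa lb pb.
have [u uU [-> ->]] := primitive_unique lx px la pa.
have [v vU [-> ->]] := primitive_unique lz pz lb pb.
have u0 := red5_units uU; have v0 := red5_units vU.
rewrite /edge_value.
have -> : u * x * (v * t) - u * y * (v * z) = u * v * (x * t - y * z) by ring.
rewrite !rmorphM !invfM /=; congr (_ ^+ 2).
set r := (red5 (x * t - y * z))^-1; set U := red5 u in u0 *; set W := red5 v in v0 *.
have -> : U * red5 y * (W * red5 t) * (U^-1 * W^-1 * r) =
  (U / U) * (W / W) * (red5 y * red5 t * r) by ring.
by rewrite !divff // !mul1r.
Qed.

(** Bezout coefficients are transformed by the inverse of A. *)
Lemma act_coprime (A : SL2 Zi) p q : coprime2 p q ->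
  coprime2 (val A 0 0 * p + val A 0 1 * q) (val A 1 0 * p + val A 1 1 * q).
Proof.
move=> [s [r sr]]; exists (s * val A 1 1 - r * val A 1 0).
exists (r * val A 0 0 - s * val A 0 1).
transitivity ((val A 0 0 * val A 1 1 - val A 0 1 * val A 1 0) * (s * p + r * q)).
  ring.
by rewrite SL2_entries sr mulr1.
Qed.

(** Modulo 2+i an element of H multiplies all second coordinates by the same
    sign, and it preserves determinants. *)
Lemma edge_inv_act (h : Gamma1) al be :
  edge_inv (gact h al) (gact h be) = edge_inv al be.
Proof.
have [A [e [hA es _ A10 A11]]] := gamma1_repr h.
have [x [y [lx px]]] := primitive_lift al; have [z [t [lz pz]]] := primitive_lift be.
rewrite (edge_invE lx px lz pz).
rewrite (edge_invE (lifts_act hA lx) (act_coprime A px)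
                   (lifts_act hA lz) (act_coprime A pz)).
rewrite /edge_value; congr ((_ / red5 _) ^+ 2).
  by rewrite !(rmorphD, rmorphM) /= A10 A11 !mul0r !add0r mulrACA signs_sqr // mul1r.
transitivity ((val A 0 0 * val A 1 1 - val A 0 1 * val A 1 0) * (x * t - y * z)).
  ring.
by rewrite SL2_entries mul1r.
Qed.

Lemma edge_inv_sym al be : edge_inv al be = edge_inv be al.
Proof.
rewrite /edge_inv /edge_value; set x := (prim_lift al).1; set y := _.2.
set z := _.1; set t := _.2.
have -> : z * y - t * x = - (x * t - y * z) by ring.
by rewrite rmorphN invrN mulrN sqrrN [red5 t * _]mulrC.
Qed.

Lemma edge_inv_diag al : edge_inv al al = 0.
Proof.
rewrite /edge_inv /edge_value [_.2 * _]mulrC subrr rmorph0 invr0 mulr0.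
by rewrite expr0n.
Qed.

(** * Representatives and the finite search *)

Lemma lifts_pt (z : Qi) x y :
  y != 0 -> Zi_to_Qi x = z * Zi_to_Qi y -> lifts (pt z) x y.
Proof.
move=> y0 E; have v0 : Zi_to_Qi y != 0.
  by rewrite -(rmorph0 Zi_to_Qi) (inj_eq Zi_to_Qi_inj).
apply/liftsE; rewrite E /=; apply/eqP.
have -> : cv2 (z * Zi_to_Qi y) (Zi_to_Qi y) = Zi_to_Qi y *: cv2 z 1.
  by rewrite scale_cv2 mulr1 mulrC.
rewrite eqEsubv -!memvE memvZ ?memv_line // andbT.
by apply/vlineP; exists (Zi_to_Qi y)^-1; rewrite scalerA mulVf ?scale1r.
Qed.

Lemma lifts_infty x : x != 0 -> lifts infty x 0.
Proof.
move=> x0; have := lifts_scale infty 1 0 x0; rewrite mulr1 mulr0 => ->.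
by apply/liftsE; rewrite rmorph0 rmorph1.
Qed.

Lemma lifts_0 : lifts (pt 0) 0 1.
Proof. by apply: lifts_pt => //; rewrite mul0r rmorph0. Qed.
Lemma lifts_1 : lifts (pt 1) 1 1.
Proof. by apply: lifts_pt => //; rewrite mul1r. Qed.
Lemma lifts_1i : lifts (pt (1 + qi)) (1 + zi) 1.
Proof. by apply: lifts_pt. Qed.
Lemma lifts_w : lifts (pt wpt) 1 (1 - zi).
Proof. by apply: lifts_pt => //; apply/eqP; vm_compute. Qed.

(** Lifts (x, y) and (z, t) of the two ends. *)
Definition edge_basis (r : 'I_3) : Zi * Zi * Zi * Zi :=
  nth (0, 0, 0, 0) [:: (0, 1, 1, 1); (1, 1, 1, 0); (0, 1, 1, 1 - zi)] r.

Definition edge_lifts (e : cusp * cusp) (v : Zi * Zi * Zi * Zi) : Prop :=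
  let: (x, y, z, t) := v in
  [/\ lifts e.1 x y, lifts e.2 z t & x * t - y * z \in Zi_units].

Lemma edge_basisP r : edge_lifts (edge_rep r) (edge_basis r).
Proof.
case: r => -[|[|[|//]]] p; rewrite /edge_rep (tnth_nth (pt 0, pt 0)) /edge_basis /=.
- by split; [exact: lifts_0|exact: lifts_1|].
- by split; [exact: lifts_1|exact: lifts_infty|].
- by split; [exact: lifts_0|exact: lifts_w|].
Qed.

(** Lifts (x, y) and (z, t) of the first two vertices, scaled by units so that
    their sum lifts the third one. *)
Definition tri_basis (t : 'I_4) : Zi * Zi * Zi * Zi :=
  nth (0, 0, 0, 0)
    [:: (0, - 1, 1, 1); (- 1, - 1, 1 + zi, 1); (0, zi, 1, 1 - zi);
        (1, 1, - zi, - zi - 1)] t.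

Definition tri_lifts (f : cusp * cusp * cusp) (v : Zi * Zi * Zi * Zi) : Prop :=
  let: (x, y, z, t) := v in
  [/\ lifts f.1.1 x y, lifts f.1.2 z t, lifts f.2 (x + z) (y + t) &
      x * t - y * z \in Zi_units].

Lemma lifts_units al x y u x' y' : u \in Zi_units ->
  (x', y') = (u * x, u * y) -> lifts al x y -> lifts al x' y'.
Proof. by move=> uU [-> ->]; move/(lifts_scale _ _ _ (Zi_units_neq0 uU)). Qed.

Lemma tri_basisP t : tri_lifts (tri_rep t) (tri_basis t).
Proof.
case: t => -[|[|[|[|//]]]] p; rewrite /tri_rep (tnth_nth (pt 0, pt 0, pt 0)) /tri_basis /=.
- split=> //; [|exact: lifts_1|exact: lifts_infty].
  by apply: (lifts_units (u := -1)) lifts_0.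
- split=> //; [|exact: lifts_1i|exact: lifts_infty].
  by apply: (lifts_units (u := -1)) lifts_1.
- split=> //; [|exact: lifts_w|].
    by apply: (lifts_units (u := zi)) lifts_0.
  by apply: (lifts_units (u := 1)) lifts_1.
- split=> //; [exact: lifts_1| |].
    by apply: (lifts_units (u := - zi)) lifts_w.
  by apply: (lifts_units (u := - zi)) lifts_1i.
Qed.

Definition I3s : seq 'I_3 :=
  [:: @Ordinal 3 0 isT; @Ordinal 3 1 isT; @Ordinal 3 2 isT].
Definition I4s : seq 'I_4 :=
  [:: @Ordinal 4 0 isT; @Ordinal 4 1 isT; @Ordinal 4 2 isT; @Ordinal 4 3 isT].
Definition F5s : seq 'F_5 := [:: 0; 1; 2%:R; 3%:R; 4%:R].

Lemma mem_F5s (c : 'F_5) : c \in F5s.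
Proof. by case: c => -[|[|[|[|[|//]]]]] p; rewrite !inE. Qed.

Definition flip_edge (b : bool) (e : cusp * cusp) := if b then (e.2, e.1) else e.
Definition flip_basis (b : bool) (v : Zi * Zi * Zi * Zi) :=
  let: (x, y, z, t) := v in if b then (z, t, x, y) else v.

Lemma flip_lifts b e v : edge_lifts e v -> edge_lifts (flip_edge b e) (flip_basis b v).
Proof.
case: v => -[[x y] z] t; case: b => // -[lx lz D]; split=> //=.
by have -> : z * y - t * x = - (x * t - y * z); [ring|apply: Zi_unitsN].
Qed.

Definition rotate_tri (f : cusp * cusp * cusp) := (f.1.2, f.2, f.1.1).
Definition flip_tri (b : bool) (f : cusp * cusp * cusp) :=
  if b then (f.1.2, f.1.1, f.2) else f.
(** The vectors w, - (v + w), - v sum up correctly and lift the second, the third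
    and the first vertex. *)
Definition rotate_basis (v : Zi * Zi * Zi * Zi) :=
  let: (x, y, z, t) := v in (z, t, - (x + z), - (y + t)).

Lemma rotate_lifts f v : tri_lifts f v -> tri_lifts (rotate_tri f) (rotate_basis v).
Proof.
case: v => -[[x y] z] t [lx lz lxz D]; split=> //=.
- by apply: (lifts_units (u := -1)) lxz => //; rewrite !mulN1r.
- by apply: (lifts_units (u := -1)) lx => //; congr pair; ring.
by have -> : z * - (y + t) - t * - (x + z) = x * t - y * z by ring.
Qed.

Lemma flip_tri_lifts b f v : tri_lifts f v -> tri_lifts (flip_tri b f) (flip_basis b v).
Proof.
case: v => -[[x y] z] t; case: b => // -[lx lz lxz D]; split=> //=.
  by rewrite [z + x]addrC [t + y]addrC.
by have -> : z * y - t * x = - (x * t - y * z); [ring|apply: Zi_unitsN].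
Qed.

Lemma det_mod5_neq0 (x y z t : Zi) : x * t - y * z \in Zi_units ->
  (red5 y != 0) || (red5 t != 0).
Proof.
move=> /red5_units; apply: contraNT; rewrite negb_or !negbK => /andP[/eqP y0 /eqP t0].
by rewrite rmorphB !rmorphM /= y0 t0 mulr0 mul0r subr0.
Qed.

(** Under call-by-value evaluation [has] would test every element of s, whereas
    this test stops at the first success. *)
Definition search T (a : pred T) (s : seq T) : bool := (find a s < size s)%N.

Lemma searchP (T : eqType) (a : pred T) s :
  search a s -> exists2 x, x \in s & a x.
Proof. by rewrite /search -has_find => /hasP. Qed.

(** The hypotheses of [transport] on a basis of determinant D with second
    coordinates c, d.  The nested conditionals avoid evaluating the later tests
    when an earlier one fails. *)
Definition match_basis (v : Zi * Zi * Zi * Zi) (D : Zi) (c d : 'F_5) (e : 'F_5) : bool :=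
  let: (x, y, z, t) := v in
  if D == x * t - y * z then
    if c == e * red5 y then d == e * red5 t else false
  else false.

(** Both lifts of an edge may be rescaled by units independently. *)
Lemma edge_table : all (fun D => all (fun c => all (fun d =>
    (c != 0) || (d != 0) ==>
    search (fun r => search (fun b => search (fun u1 => search (fun u2 =>
      search (match_basis (flip_basis b (edge_basis r)) (u1 * u2 * D)
        (red5 u1 * c) (red5 u2 * d)) signs)
    Zi_units) Zi_units) [:: false; true]) I3s) F5s) F5s) Zi_units.
Proof. by vm_compute. Qed.

(** The relation between the three lifts of a triangle only allows a common
    rescaling; the six orderings of the vertices are obtained from a flip and
    from rotations. *)
Lemma tri_table : all (fun D => all (fun c => all (fun d =>
    (c != 0) || (d != 0) ==>
    search (fun t => search (fun b => search (fun k => search (fun u =>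
      search (match_basis (iter k rotate_basis (flip_basis b (tri_basis t)))
        (u * u * D) (red5 u * c) (red5 u * d)) signs)
    Zi_units) (iota 0 3)) [:: false; true]) I4s) F5s) F5s) Zi_units.
Proof. by vm_compute. Qed.

Definition act_edge (h : Gamma1) (e : cusp * cusp) := (gact h e.1, gact h e.2).
Definition act_tri (h : Gamma1) (f : cusp * cusp * cusp) :=
  (gact h f.1.1, gact h f.1.2, gact h f.2).

Lemma edge_orbit e : unimodular e ->
  exists r b h, e = act_edge h (flip_edge b (edge_rep r)).
Proof.
case: e => al be /unimodularP[x [y [z [t [lx lz D]]]]].
have /implyP/(_ (det_mod5_neq0 D)) :=
  allP (allP (allP edge_table _ D) _ (mem_F5s (red5 y))) _ (mem_F5s (red5 t)).
move=> /searchP[r _ /searchP[b _ /searchP[u1 u1U /searchP[u2 u2U /searchP[e es]]]]].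
rewrite /match_basis; have := flip_lifts b (edge_basisP r).
move E: (flip_edge _ _) => f'.
move: (flip_basis _ _) f' E => [[[x' y'] z'] t'] [al' be'] E /= [lx' lz' D'].
case: eqP => // DE; case: eqP => // yE /eqP tE.
have det' : u1 * x * (u2 * t) - u1 * y * (u2 * z) = x' * t' - y' * z'.
  by rewrite -DE; ring.
rewrite -rmorphM /= in yE; rewrite -rmorphM /= in tE.
have [h hP] := transport D' det' es yE tE.
exists r, b, h; rewrite E /act_edge /=; congr pair.
  apply: (lifts_uniq (x := u1 * x) (y := u1 * y)).
    exact/lifts_scale/lx/Zi_units_neq0.
  by have := hP 1 0 al'; rewrite !mul1r !mul0r !addr0; apply.
apply: (lifts_uniq (x := u2 * z) (y := u2 * t)).
  exact/lifts_scale/lz/Zi_units_neq0.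
by have := hP 0 1 be'; rewrite !mul1r !mul0r !add0r; apply.
Qed.

Lemma tri_orbit f : ideal_triangle f ->
  exists t b k h, f = act_tri h (iter k rotate_tri (flip_tri b (tri_rep t))).
Proof.
case: f => -[al be] ga /idealP[x [y [z [t [lx lz lxz D]]]]].
have /implyP/(_ (det_mod5_neq0 D)) :=
  allP (allP (allP tri_table _ D) _ (mem_F5s (red5 y))) _ (mem_F5s (red5 t)).
move=> /searchP[r _ /searchP[b _ /searchP[k _ /searchP[u uU /searchP[e es]]]]].
have : tri_lifts (iter k rotate_tri (flip_tri b (tri_rep r)))
    (iter k rotate_basis (flip_basis b (tri_basis r))).
  elim: k => [|k IH] /=; last exact: rotate_lifts.
  exact/flip_tri_lifts/tri_basisP.
rewrite /match_basis.
move E: (iter k rotate_tri _) => f'.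
move: (iter k rotate_basis _) f' E => [[[x' y'] z'] t'] [[al' be'] ga'] E /= [lx' lz' lxz' D'].
case: eqP => // DE; case: eqP => // yE /eqP tE.
have det' : u * x * (u * t) - u * y * (u * z) = x' * t' - y' * z'.
  by rewrite -DE; ring.
rewrite -rmorphM /= in yE; rewrite -rmorphM /= in tE.
have [h hP] := transport D' det' es yE tE.
exists r, b, k, h; rewrite E /act_tri /=; congr (_, _, _).
- apply: (lifts_uniq (x := u * x) (y := u * y)).
    exact/lifts_scale/lx/Zi_units_neq0.
  by have := hP 1 0 al'; rewrite !mul1r !mul0r !addr0; apply.
- apply: (lifts_uniq (x := u * z) (y := u * t)).
    exact/lifts_scale/lz/Zi_units_neq0.
  by have := hP 0 1 be'; rewrite !mul1r !mul0r !add0r; apply.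
apply: (lifts_uniq (x := u * (x + z)) (y := u * (y + t))).
  exact/lifts_scale/lxz/Zi_units_neq0.
by have := hP 1 1 ga'; rewrite !mul1r !mulrDr; apply.
Qed.

(** * Orbits of edges and triangles *)

Lemma gact_inj (h : Gamma1) : injective (gact h : cusp -> cusp).
Proof. by move=> x y /(congr1 (gact h^-1%g)); rewrite -!gactM mulVg !gact1. Qed.

Lemma mem_translate h S x : (x \in translate h S) = (gact h^-1%g x \in S).
Proof.
apply/imfsetP/idP => [[y yS ->]|xS]; first by rewrite -gactM mulVg gact1.
by exists (gact h^-1%g x); rewrite // -gactM mulgV gact1.
Qed.

Lemma gactV_eq (h : Gamma1) (x y : cusp) : (gact h^-1%g x == y) = (x == gact h y).
Proof.
by apply/eqP/eqP => [<-|->]; rewrite -gactM ?mulgV ?mulVg gact1.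
Qed.

Lemma mem_edge_set e x : (x \in edge_set e) = (x == e.1) || (x == e.2).
Proof. by rewrite /edge_set in_fset2. Qed.

Lemma mem_triangle_set f x :
  (x \in triangle_set f) = [|| x == f.1.1, x == f.1.2 | x == f.2].
Proof. by rewrite /triangle_set in_fsetU in_fset2 in_fset1 orbA. Qed.

Lemma translate_edge h e : translate h (edge_set e) = edge_set (act_edge h e).
Proof. by apply/fsetP => x; rewrite mem_translate !mem_edge_set /= !gactV_eq. Qed.

Lemma translate_tri h f : translate h (triangle_set f) = triangle_set (act_tri h f).
Proof. by apply/fsetP => x; rewrite mem_translate !mem_triangle_set /= !gactV_eq. Qed.

Lemma edge_set_flip b e : edge_set (flip_edge b e) = edge_set e.
Proof.
case: b; last reflexivity.
rewrite /flip_edge /edge_set /=.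
exact: fsetUC. Qed.

Lemma triangle_set_flip b f : triangle_set (flip_tri b f) = triangle_set f.
Proof.
case: b; last reflexivity.
rewrite /flip_tri /triangle_set /=.
by move: (fset1 f.1.1) (fset1 f.1.2) (fset1 f.2) => A B C; rewrite (fsetUC A).
Qed.

Lemma triangle_set_rotate k f : triangle_set (iter k rotate_tri f) = triangle_set f.
Proof.
elim: k => [|k <-]; first reflexivity.
rewrite iterS; move: (iter k _ f) => g.
rewrite /rotate_tri /triangle_set /=.
by move: (fset1 g.1.1) (fset1 g.1.2) (fset1 g.2) => A B C; rewrite fsetUC fsetUA.
Qed.

Lemma adjacent_neq al be : adjacent al be -> al != be.
Proof.
move=> /unimodularP[x [y [z [t [lx lz D]]]]]; apply/eqP => E; rewrite -E in lz.
by move: D; rewrite (lifts_parallel lx lz) subrr.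
Qed.

Lemma uniq3 (T : eqType) (a b c : T) :
  a != b -> a != c -> b != c -> uniq [:: a; b; c].
Proof. by rewrite /= !inE negb_or => -> -> ->. Qed.

Section SetSum.
Variable F : cusp -> cusp -> 'F_5.
Hypothesis F_act : forall (h : Gamma1) al be, F (gact h al) (gact h be) = F al be.
Hypothesis F_sym : forall al be, F al be = F be al.
Hypothesis F_diag : forall al, F al al = 0.

(** Every pair is counted twice, which loses nothing since 2 is invertible in
    F_5. *)
Definition set_sum (S : {fset cusp}) : 'F_5 := \sum_(x <- S) \sum_(y <- S) F x y.

Lemma set_sum_translate h S : set_sum (translate h S) = set_sum S.
Proof.
rewrite /set_sum /translate big_imfset /=; last by move=> x y _ _ /gact_inj.
apply: eq_bigr => x _; rewrite big_imfset /=; last by move=> ? ? _ _ /gact_inj.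
by apply: eq_bigr => y _; rewrite F_act.
Qed.

Lemma set_sum_orbit h h' S S' :
  translate h S = translate h' S' -> set_sum S = set_sum S'.
Proof.
by move=> E; rewrite -(set_sum_translate h S) E (set_sum_translate h' S').
Qed.

Lemma set_sum_seq (S : {fset cusp}) s : uniq s -> S =i s ->
  set_sum S = \sum_(x <- s) \sum_(y <- s) F x y.
Proof.
move=> us Ss; have pS : perm_eq S s by apply: uniq_perm => //; apply: fset_uniq.
by rewrite /set_sum (perm_big _ pS); apply: eq_bigr => x _; rewrite (perm_big _ pS).
Qed.

Lemma set_sum_edge e : unimodular e -> set_sum (edge_set e) = F e.1 e.2 *+ 2.
Proof.
case: e => a b /adjacent_neq ab; rewrite (set_sum_seq (s := [:: a; b])).
- by rewrite !big_cons !big_nil !F_diag (F_sym b a) !addr0 add0r mulr2n.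
- by rewrite /= inE ab.
- by move=> x; rewrite mem_edge_set !inE.
Qed.

Lemma set_sum_tri f : ideal_triangle f ->
  set_sum (triangle_set f) = (F f.1.1 f.1.2 + F f.1.2 f.2 + F f.2 f.1.1) *+ 2.
Proof.
case: f => -[a b] c /ideal_adjacent[/adjacent_neq ab /adjacent_neq bc].
move=> /adjacent_sym/adjacent_neq ac.
rewrite (set_sum_seq (s := [:: a; b; c])).
- rewrite !big_cons !big_nil !F_diag (F_sym b a) (F_sym c b) (F_sym a c) /=.
  by rewrite mulr2n; ring.
- exact (uniq3 ab ac bc).
- by move=> x; rewrite mem_triangle_set !inE.
Qed.
End SetSum.

Lemma edge_lifts_unimodular e v : edge_lifts e v -> unimodular e.
Proof.
case: e v => a b [[[x y] z] t] [lx lz D]; apply/unimodularP.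
by exists x, y, z, t.
Qed.

Lemma tri_lifts_ideal f v : tri_lifts f v -> ideal_triangle f.
Proof.
case: f v => -[a b] c [[[x y] z] t] [lx lz lxz D]; apply/idealP.
by exists x, y, z, t.
Qed.

Lemma edge_rep_unimodular r : unimodular (edge_rep r).
Proof. exact: edge_lifts_unimodular (edge_basisP r). Qed.

Lemma tri_rep_ideal t : ideal_triangle (tri_rep t).
Proof. exact: tri_lifts_ideal (tri_basisP t). Qed.

Lemma edge_inv_lifts e v : edge_lifts e v ->
  edge_inv e.1 e.2 = let: (x, y, z, t) := v in edge_value x y z t.
Proof.
case: e v => a b [[[x y] z] t] [/= lx lz D]; have [px pz] := det_primitive D.
exact: edge_invE.
Qed.

Lemma edge_inv_rep r : edge_inv (edge_rep r).1 (edge_rep r).2 =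
  nth 0 [:: 1; 0; - 1] r.
Proof.
rewrite (edge_inv_lifts (edge_basisP r)).
by case: r => -[|[|[|//]]] p; apply/eqP; vm_compute.
Qed.

(** The invariants 1, 0, -1 of the representatives are distinct. *)
Lemma edge_orbits : orbit_representatives unoriented_edge
  (fun r : 'I_3 => edge_set (edge_rep r)).
Proof.
split=> [r|S [e [/edge_orbit[r [b [h ->]]] ->]]].
  by exists (edge_rep r); split=> //; apply: edge_rep_unimodular.
rewrite -translate_edge edge_set_flip.
exists r; split=> [|r' [h' E]]; first by exists h.
have sum k := set_sum_edge edge_inv_sym edge_inv_diag (edge_rep_unimodular k).
have := etrans (esym (sum r)) (etrans (set_sum_orbit edge_inv_act E) (sum r')).
rewrite !edge_inv_rep => /eqP {h h' E}.
case: r r' => -[|[|[|//]]] p [[|[|[|//]]] p'] // _; exact/val_inj.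
Qed.

(** On the four triangles the invariants of the sides sum to 1, -1, 1, -1, so a
    second symmetric function is needed. *)
Definition edge_inv2 al be := edge_inv al be ^+ 2.

Definition tri_values (t : 'I_4) : 'F_5 * 'F_5 * 'F_5 :=
  nth (0, 0, 0) [:: (1, 0, 0); (-1, 0, 0); (-1, 1, 1); (1, -1, -1)] t.

Lemma edge_inv_tri t : let f := tri_rep t in
  (edge_inv f.1.1 f.1.2, edge_inv f.1.2 f.2, edge_inv f.2 f.1.1) = tri_values t.
Proof.
have E k : edge_lifts ((iter k rotate_tri (tri_rep t)).1)
    (iter k rotate_basis (tri_basis t)).
  have : tri_lifts (iter k rotate_tri (tri_rep t)) (iter k rotate_basis (tri_basis t)).
    by elim: k => [|k IH] /=; [exact: tri_basisP|exact: rotate_lifts].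
  move: (iter k rotate_tri _) (iter k rotate_basis _).
  by move=> [[a b] c] [[[x y] z] t'] [].
have := edge_inv_lifts (E 0%N); have := edge_inv_lifts (E 1%N).
have := edge_inv_lifts (E 2%N) => /= -> -> ->.
by case: t {E} => -[|[|[|[|//]]]] p; apply/eqP; vm_compute.
Qed.

(** The sum of the invariants of the sides and the sum of their squares are
    (1, 1), (-1, 1), (1, 3), (-1, 3). *)
Lemma tri_orbits : orbit_representatives unoriented_triangle
  (fun t : 'I_4 => triangle_set (tri_rep t)).
Proof.
split=> [t|S [f [/tri_orbit[t [b [k [h ->]]]] ->]]].
  by exists (tri_rep t); split=> //; apply: tri_rep_ideal.
rewrite -translate_tri triangle_set_rotate triangle_set_flip.
exists t; split=> [|t' [h' E]]; first by exists h.
have inv2_act (g : Gamma1) al be : edge_inv2 (gact g al) (gact g be) = edge_inv2 al be.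
  by rewrite /edge_inv2 edge_inv_act.
have inv2_sym al be : edge_inv2 al be = edge_inv2 be al.
  by rewrite /edge_inv2 edge_inv_sym.
have inv2_diag al : edge_inv2 al al = 0 by rewrite /edge_inv2 edge_inv_diag expr0n.
have sum j : set_sum edge_inv (triangle_set (tri_rep j)) =
    (let: (p, q, s) := tri_values j in p + q + s) *+ 2.
  by rewrite -edge_inv_tri (set_sum_tri edge_inv_sym edge_inv_diag (tri_rep_ideal j)).
have sum2 j : set_sum edge_inv2 (triangle_set (tri_rep j)) =
    (let: (p, q, s) := tri_values j in p ^+ 2 + q ^+ 2 + s ^+ 2) *+ 2.
  by rewrite -edge_inv_tri (set_sum_tri inv2_sym inv2_diag (tri_rep_ideal j)).
have /eqP := etrans (esym (sum2 t)) (etrans (set_sum_orbit inv2_act E) (sum2 t')).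
have /eqP := etrans (esym (sum t)) (etrans (set_sum_orbit edge_inv_act E) (sum t')).
clear E sum sum2.
case: t t' => -[|[|[|[|//]]]] p [[|[|[|[|//]]]] p'] // _ _; exact/val_inj.
Qed.

(** * Stabilizers *)

Lemma gamma1_trace (h : Gamma1) :
  exists A e, [/\ val h = psl2_class A, e \in signs &
                  red5 (val A 0 0 + val A 1 1) = e *+ 2].
Proof.
have [A [e [hA es A00 _ A11]]] := gamma1_repr h.
by exists A, e; split=> //; rewrite rmorphD /= A00 A11 mulr2n.
Qed.

Lemma gamma1_eq1 (h : Gamma1) (A : SL2 Zi) l :
  val h = psl2_class A -> l \in [:: 1; -1] ->
  val A = mx2 l 0 0 l -> h = 1%g.
Proof.
move=> hA l1 AE; apply/val_inj; rewrite hA [RHS]/=.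
apply/eqP/psl2_classP; rewrite AE val_sl21.
have E : mx2 1 0 0 1 = 1%:M :> 'M[Zi]_2.
  by rewrite [RHS]mx2_entries !mxE.
rewrite -E; move: l1; rewrite !inE => /orP[] /eqP->; [by left|right].
by rewrite [RHS]mx2_entries !mxE /= oppr0.
Qed.

Lemma act_lift (h : Gamma1) (A : SL2 Zi) al al' x y x' y' :
    val h = psl2_class A -> lifts al x y -> coprime2 x y ->
    lifts al' x' y' -> coprime2 x' y' -> gact h al = al' ->
  exists2 u, u \in Zi_units &
    val A 0 0 * x + val A 0 1 * y = u * x' /\
    val A 1 0 * x + val A 1 1 * y = u * y'.
Proof.
move=> hA lx px lx' px' E; have := lifts_act hA lx; rewrite E => lA.
have [u uU [uE uE']] := primitive_unique lx' px' lA (act_coprime A px).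
by exists u.
Qed.

(** The trace and the determinant of A, computed in the basis (x, y), (z, t). *)
Lemma basis_trace (A : SL2 Zi) (x y z t X Y Z T : Zi) :
    val A 0 0 * x + val A 0 1 * y = X -> val A 1 0 * x + val A 1 1 * y = Y ->
    val A 0 0 * z + val A 0 1 * t = Z -> val A 1 0 * z + val A 1 1 * t = T ->
  (val A 0 0 + val A 1 1) * (x * t - y * z) = (X * t - Y * z) + (x * T - y * Z) /\
  X * T - Y * Z = x * t - y * z.
Proof.
move=> <- <- <- <-; split; first by ring.
transitivity ((val A 0 0 * val A 1 1 - val A 0 1 * val A 1 0) * (x * t - y * z)).
  ring.
by rewrite SL2_entries mul1r.
Qed.

Lemma Zi_unit_cancel (D x y : Zi) : D \in Zi_units -> x * D = y * D -> x = y.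
Proof.
by move=> /Zi_units_neq0 D0; rewrite ![_ * D]mulrC; apply: Zi_mulfI.
Qed.

Lemma signs_double e : e \in signs -> e *+ 2 != 0.
Proof. by rewrite !inE => /orP[] /eqP->. Qed.

(** In the basis of lifts the matrix is diagonal with entries u and 1 / u.  For
    u = i or - i the trace would be 0, hence u = 1 or u = -1 and h is trivial. *)
Lemma adjacent_fixed (h : Gamma1) al be : adjacent al be ->
  gact h al = al -> gact h be = be -> h = 1%g.
Proof.
move=> /unimodularP[x [y [z [t [lx lz D]]]]] ha hb.
have [px pz] := det_primitive D; have [A [e [hA es tr]]] := gamma1_trace h.
have [u uU [X Y]] := act_lift hA lx px lx px ha.
have [v vU [Z T]] := act_lift hA lz pz lz pz hb.
have [trD detD] := basis_trace X Y Z T.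
have uv : u * v = 1.
  apply: (Zi_unit_cancel D); rewrite mul1r -[RHS]detD; ring.
have trE : val A 0 0 + val A 1 1 = u + v.
  apply: (Zi_unit_cancel D); rewrite trD; ring.
have [u1 uE] : u \in [:: 1; -1] /\ v = u.
  move/eqP: uv; move: tr (signs_double es) uU vU; rewrite trE !inE => tr e0.
  move: tr => /[swap] /or4P[] /eqP-> /[swap] /or4P[] /eqP-> // tr _;
    by move: e0; rewrite -tr.
apply: (gamma1_eq1 (l := u) hA u1); rewrite uE in Z T.
rewrite [LHS]mx2_entries; congr mx2; apply: (Zi_unit_cancel D).
- transitivity (t * (val A 0 0 * x + val A 0 1 * y) -
                y * (val A 0 0 * z + val A 0 1 * t)); first by ring.
  by rewrite X Z; ring.
- transitivity (x * (val A 0 0 * z + val A 0 1 * t) -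
                z * (val A 0 0 * x + val A 0 1 * y)); first by ring.
  by rewrite X Z; ring.
- transitivity (t * (val A 1 0 * x + val A 1 1 * y) -
                y * (val A 1 0 * z + val A 1 1 * t)); first by ring.
  by rewrite Y T; ring.
- transitivity (x * (val A 1 0 * z + val A 1 1 * t) -
                z * (val A 1 0 * x + val A 1 1 * y)); first by ring.
  by rewrite Y T; ring.
Qed.

(** In the basis of lifts the matrix is antidiagonal, so its trace is 0. *)
Lemma adjacent_not_swapped (h : Gamma1) al be : adjacent al be ->
  gact h al = be -> gact h be = al -> False.
Proof.
move=> /unimodularP[x [y [z [t [lx lz D]]]]] ha hb.
have [px pz] := det_primitive D; have [A [e [hA es tr]]] := gamma1_trace h.
have [u uU [X Y]] := act_lift hA lx px lz pz ha.
have [v vU [Z T]] := act_lift hA lz pz lx px hb.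
have [trD _] := basis_trace X Y Z T.
have trE : val A 0 0 + val A 1 1 = 0.
  apply: (Zi_unit_cancel D); rewrite trD; ring.
by move: (signs_double es); rewrite -tr trE rmorph0 eqxx.
Qed.

(** In the basis of lifts the matrix has columns u w and - u (v + w): its trace is
    - u and its determinant u^2.  Thus the trace has square 1, but 2^2 is not 1
    in F_5. *)
Lemma ideal_not_rotated (h : Gamma1) al be ga : ideal_triangle (al, be, ga) ->
  gact h al = be -> gact h be = ga -> gact h ga = al -> False.
Proof.
move=> /idealP[x [y [z [t [lx lz lxz D]]]]] ha hb hc.
have [px pz] := det_primitive D; have [A [e [hA es tr]]] := gamma1_trace h.
have pxz : coprime2 (x + z) (y + t).
  have D' : x * (y + t) - y * (x + z) \in Zi_units.
    by have -> : x * (y + t) - y * (x + z) = x * t - y * z by ring.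
  by have [] := det_primitive D'.
have [u uU [X Y]] := act_lift hA lx px lz pz ha.
have [v vU [Z T]] := act_lift hA lz pz lxz pxz hb.
have [w wU [X' Y']] := act_lift hA lxz pxz lx px hc.
have [trD detD] := basis_trace X Y Z T.
have vE : v = - u.
  apply/eqP; rewrite -addr_eq0; apply/eqP; apply: (Zi_unit_cancel D).
  transitivity (x * (u * t + v * (y + t)) - y * (u * z + v * (x + z))); first by ring.
  have -> : u * z + v * (x + z) = w * x by rewrite -X -Z -X'; ring.
  have -> : u * t + v * (y + t) = w * y by rewrite -Y -T -Y'; ring.
  ring.
have trE : val A 0 0 + val A 1 1 = v.
  by apply: (Zi_unit_cancel D); rewrite trD; ring.
have v2 : v * v = 1.
  apply: (Zi_unit_cancel D); rewrite mul1r -[RHS]detD.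
  by rewrite -[in LHS](opprK v) vE; ring.
have := congr1 red5 v2; rewrite -trE rmorphM rmorph1 /= tr.
by move: es; rewrite !inE => /orP[] /eqP-> /eqP.
Qed.

Lemma edge_stabilizers : trivial_stabilizers unoriented_edge.
Proof.
move=> S [[al be] [ab ->]] h E.
have img x : x \in edge_set (al, be) -> gact h x = al \/ gact h x = be.
  move=> xS; have : gact h x \in translate h (edge_set (al, be)).
    by rewrite mem_translate -gactM mulVg gact1.
  by rewrite E mem_edge_set => /orP[] /eqP; [left|right].
have [ha|ha] : gact h al = al \/ gact h al = be by apply: img; rewrite mem_edge_set eqxx.
  have [hb|hb] : gact h be = al \/ gact h be = be.
    by apply: img; rewrite mem_edge_set eqxx orbT.
    by have := adjacent_neq ab; rewrite -(inj_eq (@gact_inj h)) ha hb eqxx.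
  exact (adjacent_fixed ab ha hb).
have [hb|hb] : gact h be = al \/ gact h be = be.
  by apply: img; rewrite mem_edge_set eqxx orbT.
- by have := adjacent_not_swapped ab ha hb.
by have := adjacent_neq ab; rewrite -(inj_eq (@gact_inj h)) ha hb eqxx.
Qed.

Lemma ideal_swap al be ga : ideal_triangle (al, be, ga) -> ideal_triangle (be, al, ga).
Proof.
move=> /idealP[x [y [z [t [? ? ? ?]]]]].
have Tl : tri_lifts (al, be, ga) (x, y, z, t) by [].
exact: (tri_lifts_ideal (flip_tri_lifts true Tl)).
Qed.

(** A permutation of the vertices that is not a rotation fixes or swaps the ends
    of some side. *)
Lemma triangle_stabilizers : trivial_stabilizers unoriented_triangle.
Proof.
move=> S [[[a b] c] [T ->]] h E.
have [ab bc ca] := ideal_adjacent T.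
have ab' := adjacent_neq ab; have bc' := adjacent_neq bc.
have ca' := adjacent_neq ca.
have img x : x \in triangle_set (a, b, c) ->
    [\/ gact h x = a, gact h x = b | gact h x = c].
  move=> xS; have : gact h x \in translate h (triangle_set (a, b, c)).
    by rewrite mem_translate -gactM mulVg gact1.
  by rewrite E mem_triangle_set => /or3P[] /eqP;
    [constructor 1|constructor 2|constructor 3].
have ia : [\/ gact h a = a, gact h a = b | gact h a = c].
  by apply: img; rewrite mem_triangle_set; apply/or3P; apply: Or31 (eqxx _).
have ib : [\/ gact h b = a, gact h b = b | gact h b = c].
  by apply: img; rewrite mem_triangle_set; apply/or3P; apply: Or32 (eqxx _).
have ic : [\/ gact h c = a, gact h c = b | gact h c = c].
  by apply: img; rewrite mem_triangle_set; apply/or3P; apply: Or33 (eqxx _).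
rewrite -(inj_eq (@gact_inj h)) in ab'; rewrite -(inj_eq (@gact_inj h)) in bc'.
rewrite -(inj_eq (@gact_inj h)) in ca'.
have dab k : gact h a = k -> gact h b = k -> h = 1%g.
  by move=> ha hb; move: ab'; rewrite ha hb eqxx.
have dbc k : gact h b = k -> gact h c = k -> h = 1%g.
  by move=> ha hb; move: bc'; rewrite ha hb eqxx.
have dca k : gact h c = k -> gact h a = k -> h = 1%g.
  by move=> ha hb; move: ca'; rewrite ha hb eqxx.
case: ia => ha; case: ib => hb.
- exact (dab _ ha hb).
- exact (adjacent_fixed ab ha hb).
- case: ic => hc; [exact (dca _ hc ha)| |exact (dbc _ hb hc)].
  by case: (adjacent_not_swapped bc hb hc).
- by case: (adjacent_not_swapped ab ha hb).
- exact (dab _ ha hb).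
- case: ic => hc; [|exact (dca _ hc ha)|exact (dbc _ hb hc)].
  by case: (ideal_not_rotated T ha hb hc).
- case: ic => hc; [exact (dbc _ hb hc)| |exact (dca _ hc ha)].
  by case: (ideal_not_rotated (ideal_swap T) hb ha hc).
- case: ic => hc; [|exact (dbc _ hb hc)|exact (dca _ hc ha)].
  by case: (adjacent_not_swapped ca hc ha).
- exact (dab _ ha hb).
Qed.

(** * Quotients of left modules *)

Section QuotientModule.
Variables (R : nzRingType) (U : lmodType R) (S : zmodClosed U).

(** The stability of S under scaling is an argument of the type because the
    module structure depends on it. *)
Definition quotMod of (forall (a : R) x, x \in S -> a *: x \in S) : Type :=
  Quotient.quot S.

Variable S_scale : forall (a : R) x, x \in S -> a *: x \in S.
Local Notation Q := (quotMod S_scale).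
HB.instance Definition _ := GRing.Zmodule.on Q.

Definition quot_pi (x : U) : Q := \pi_(Quotient.quot S)%qT x.

Lemma quot_piD x y : quot_pi (x + y) = quot_pi x + quot_pi y.
Proof. exact: raddfD. Qed.

Lemma quot_piP x y : reflect (quot_pi x = quot_pi y) (x - y \in S).
Proof. by rewrite Quotient.idealrBE; apply: eqP. Qed.

Lemma quot_piK (x : Q) : quot_pi (repr (x : Quotient.quot S)) = x.
Proof. exact: reprK. Qed.

Definition quot_scale (a : R) (x : Q) : Q := quot_pi (a *: repr (x : Quotient.quot S)).

Lemma quot_piZ a x : quot_pi (a *: x) = quot_scale a (quot_pi x).
Proof.
by apply/quot_piP; rewrite -scalerBr; apply/S_scale/quot_piP; rewrite quot_piK.
Qed.

Fact quot_scaleA a b x : quot_scale a (quot_scale b x) = quot_scale (a * b) x.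
Proof. by rewrite -(quot_piK x) -!quot_piZ scalerA. Qed.
Fact quot_scale1 : left_id 1 quot_scale.
Proof. by move=> x; rewrite -(quot_piK x) -!quot_piZ scale1r. Qed.
Fact quot_scaleDr : right_distributive quot_scale +%R.
Proof.
move=> a x y; rewrite -(quot_piK x) -(quot_piK y) -quot_piD.
by rewrite -!quot_piZ scalerDr quot_piD.
Qed.
Fact quot_scaleDl x : {morph quot_scale^~ x : a b / a + b}.
Proof. by move=> a b; rewrite -(quot_piK x) -!quot_piZ scalerDl quot_piD. Qed.
HB.instance Definition _ := GRing.Zmodule_isLmodule.Build R Q
  quot_scaleA quot_scale1 quot_scaleDr quot_scaleDl.

Lemma quot_pi_linear : linear quot_pi.
Proof. by move=> a x y; rewrite quot_piD quot_piZ. Qed.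
HB.instance Definition _ := GRing.isLinear.Build R U Q *:%R quot_pi quot_pi_linear.

Lemma quot_pi_eq0 x : (quot_pi x == 0) = (x \in S).
Proof.
by rewrite -(raddf0 quot_pi) -[x in RHS]subr0; apply/eqP/idP => /quot_piP.
Qed.
End QuotientModule.

(** * Boundaries of the four triangles *)

Lemma act_lifts_class (g : Gamma1) x y z t al p q :
  is_class_of (val g) (mx2 x y z t) -> lifts al p q ->
  lifts (gact g al) (x * p + y * q) (z * p + t * q).
Proof.
by move=> [A [AE gA]] /(lifts_act gA); rewrite AE !mxE.
Qed.

(** Cusps are compared on lifts, which may differ by the unit u. *)
Lemma act_eq (g : Gamma1) x y z t al be p q p' q' u :
  is_class_of (val g) (mx2 x y z t) -> lifts al p q -> lifts be p' q' ->
  u \in Zi_units -> (x * p + y * q, z * p + t * q) = (u * p', u * q') ->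
  gact g al = be.
Proof.
move=> gM lal lbe uU E; apply: lifts_uniq (act_lifts_class gM lal) _.
exact: lifts_units uU E lbe.
Qed.

Lemma gamma1_exists x y z t e : x * t - y * z = 1 -> e \in signs ->
  red5 z = 0 -> red5 t = e -> exists g : Gamma1, is_class_of (val g) (mx2 x y z t).
Proof.
move=> D es z0 te; have [A AE] := sl2_exists D.
have gA : gamma1_pred (psl2_class A) by apply: (gamma1_intro es); rewrite AE !mxE.
by exists (exist (fun g => gamma1_pred g) _ gA), A.
Qed.

Lemma lifts_infty1 : lifts infty 1 0.
Proof. by apply: lifts_infty. Qed.

Lemma act_edgeM g h e : act_edge (g * h)%g e = act_edge g (act_edge h e).
Proof. by rewrite /act_edge !gactM. Qed.

Lemma act_edge_unimodular h e : unimodular e -> unimodular (act_edge h e).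
Proof. exact: unimodular_act. Qed.

(** Stated for abstract ring elements: the matrix product is expanded without
    looking into the group ring. *)
Lemma boundary_mx_sum (R : nzRingType) (V : lmodType R) (al be ga de ca : R)
    (M := mx_of_rows 3 4 [:: [:: 1; 0; - (1 + ca); ca];
                             [:: 1 - be; al - 1; 0; 0];
                             [:: 0; - de; 1; ga + de]])
    (v : 'I_3 -> V) (v1 v2 v3 : V) :
    (forall r, v r = nth 0 [:: v1; v2; v3] r) ->
  [/\ \sum_(r < 3) M r (@Ordinal 4 0 isT) *: v r = v1 + (1 - be) *: v2,
      \sum_(r < 3) M r (@Ordinal 4 1 isT) *: v r = (al - 1) *: v2 - de *: v3,
      \sum_(r < 3) M r (@Ordinal 4 2 isT) *: v r = - ((1 + ca) *: v1) + v3 &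
      \sum_(r < 3) M r (@Ordinal 4 3 isT) *: v r = ca *: v1 + (ga + de) *: v3].
Proof.
move=> vE; split; rewrite !big_ord_recl big_ord0 !mxE !vE /=;
  by rewrite ?(scale0r, scale1r, scaleNr, addr0, add0r).
Qed.

Section Boundary.
Variables a b c d : Gamma1.
Hypothesis aE : is_class_of (val a) (mx2 1 zi 0 1).
Hypothesis bE : is_class_of (val b) (mx2 1 (- 1) 0 1).
Hypothesis cE : is_class_of (val c) (mx2 (- 2%:R * zi) zi (- 2%:R - zi) (1 + zi)).
Hypothesis dE : is_class_of (val d)
  (mx2 (- 1) (1 + zi) (- 1 + 2%:R * zi) (2%:R - zi)).

Lemma a_1 : gact a (pt 1) = pt (1 + qi).
Proof. by apply: (act_eq (u := 1) aE lifts_1 lifts_1i). Qed.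
Lemma a_infty : gact a infty = infty.
Proof. by apply: (act_eq (u := 1) aE lifts_infty1 lifts_infty1). Qed.
Lemma b_1 : gact b (pt 1) = pt 0.
Proof. by apply: (act_eq (u := 1) bE lifts_1 lifts_0). Qed.
Lemma b_infty : gact b infty = infty.
Proof. by apply: (act_eq (u := 1) bE lifts_infty1 lifts_infty1). Qed.
Lemma c_0 : gact c (pt 0) = pt wpt.
Proof. by apply: (act_eq (u := zi) cE lifts_0 lifts_w). Qed.
Lemma c_w : gact c (pt wpt) = pt (1 + qi).
Proof. by apply: (act_eq (u := - zi) cE lifts_w lifts_1i). Qed.
Lemma d_0 : gact d^-1%g (pt 0) = pt (1 + qi).
Proof.
apply: (@gact_inj d); rewrite -gactM mulgV gact1; symmetry.
by apply: (act_eq (u := -1) dE lifts_1i lifts_0).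
Qed.
Lemma d_w : gact d^-1%g (pt wpt) = pt 1.
Proof.
apply: (@gact_inj d); rewrite -gactM mulgV gact1; symmetry.
by apply: (act_eq (u := zi) dE lifts_1 lifts_w).
Qed.
Lemma ca_0 : gact (c^-1 * a)%g (pt 0) = pt 1.
Proof.
apply: (@gact_inj c); rewrite gactM -[LHS]gactM mulgV gact1.
apply: (lifts_uniq (act_lifts_class aE lifts_0)).
by apply: lifts_units (_ : - 1 \in Zi_units) _ (act_lifts_class cE lifts_1).
Qed.
Lemma ca_1 : gact (c^-1 * a)%g (pt 1) = pt wpt.
Proof.
apply: (@gact_inj c); rewrite gactM -[LHS]gactM mulgV gact1.
by rewrite a_1 c_w.
Qed.

Section Symbol.
Variables (V : lmodType ZH) (F : cusp * cusp -> V).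
Hypothesis F_act : forall h e, unimodular e -> F (act_edge h e) = (gr_of h : ZH) *: F e.
Hypothesis F_rev : forall e, unimodular e -> F (e.2, e.1) = - F e.

(** The boundary of a triangle under F.  It is studied for any equivariant
    antisymmetric F and used for edge symbols, for the map to the Steinberg
    module and for the cochain of a triple. *)
Definition cycle_sum (f : cusp * cusp * cusp) : V :=
  F (f.1.1, f.1.2) + F (f.1.2, f.2) + F (f.2, f.1.1).

Lemma edge1_unimodular : unimodular edge1.
Proof. exact: (edge_rep_unimodular (@Ordinal 3 0 isT)). Qed.
Lemma edge2_unimodular : unimodular edge2.
Proof. exact: (edge_rep_unimodular (@Ordinal 3 1 isT)). Qed.
Lemma edge3_unimodular : unimodular edge3.
Proof. exact: (edge_rep_unimodular (@Ordinal 3 2 isT)). Qed.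

Lemma symbol_translate h e e' : unimodular e -> act_edge h e = e' -> 
  F e' = (gr_of h : ZH) *: F e /\ F (e'.2, e'.1) = - ((gr_of h : ZH) *: F e).
Proof.
move=> eU <-; split; first exact: F_act.
by rewrite F_rev ?F_act //; apply: act_edge_unimodular.
Qed.

Lemma cycle_sum_eq f x y z : F (f.1.1, f.1.2) = x -> F (f.1.2, f.2) = y ->
  F (f.2, f.1.1) = z -> cycle_sum f = x + y + z.
Proof. by rewrite /cycle_sum => -> -> ->. Qed.

Lemma cycle_sumA : cycle_sum triA = F edge1 + (1 - gr_of b : ZH) *: F edge2.
Proof.
have [_ E] : F (pt 0, infty) = (gr_of b : ZH) *: F edge2 /\
             F (infty, pt 0) = - ((gr_of b : ZH) *: F edge2).
  by apply: symbol_translate edge2_unimodular _; rewrite /act_edge /= b_1 b_infty.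
rewrite (cycle_sum_eq (f := triA) (erefl (F edge1)) (erefl (F edge2)) E).
by move: (gr_of b) (F edge1) (F edge2) => g x y; rewrite scalerBl scale1r addrA.
Qed.

Lemma cycle_sumB : cycle_sum triB =
  (gr_of a - 1 : ZH) *: F edge2 - (gr_of d^-1%g : ZH) *: F edge3.
Proof.
have [_ E] : F (pt (1 + qi), pt 1) = (gr_of d^-1%g : ZH) *: F edge3 /\
             F (pt 1, pt (1 + qi)) = - ((gr_of d^-1%g : ZH) *: F edge3).
  by apply: symbol_translate edge3_unimodular _; rewrite /act_edge /= d_0 d_w.
have [E' _] : F (pt (1 + qi), infty) = (gr_of a : ZH) *: F edge2 /\
             F (infty, pt (1 + qi)) = - ((gr_of a : ZH) *: F edge2).
  by apply: symbol_translate edge2_unimodular _; rewrite /act_edge /= a_1 a_infty.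
rewrite (cycle_sum_eq (f := triB) E E' (F_rev edge2_unimodular)).
move: (gr_of a) (gr_of d^-1%g) (F edge2) (F edge3) => g g' x y.
by rewrite scalerBl scale1r -addrA addrC.
Qed.

Lemma cycle_sumE : cycle_sum triE =
  - ((1 + gr_of (c^-1 * a)%g : ZH) *: F edge1) + F edge3.
Proof.
have [_ E] : F (pt 1, pt wpt) = (gr_of (c^-1 * a)%g : ZH) *: F edge1 /\
             F (pt wpt, pt 1) = - ((gr_of (c^-1 * a)%g : ZH) *: F edge1).
  by apply: symbol_translate edge1_unimodular _; rewrite /act_edge /= ca_0 ca_1.
rewrite (cycle_sum_eq (f := triE) (erefl (F edge3)) E (F_rev edge1_unimodular)).
move: (gr_of _) (F edge1) (F edge3) => g x y.
by rewrite scalerDl scale1r opprD -addrA addrC [- (g *: x) - _]addrC.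
Qed.

Lemma cycle_sumF : cycle_sum triF =
  (gr_of (c^-1 * a)%g : ZH) *: F edge1 + (gr_of c + gr_of d^-1%g : ZH) *: F edge3.
Proof.
have [E1 _] : F (pt 1, pt wpt) = (gr_of (c^-1 * a)%g : ZH) *: F edge1 /\
             F (pt wpt, pt 1) = - ((gr_of (c^-1 * a)%g : ZH) *: F edge1).
  by apply: symbol_translate edge1_unimodular _; rewrite /act_edge /= ca_0 ca_1.
have [E2 _] : F (pt (1 + qi), pt 1) = (gr_of d^-1%g : ZH) *: F edge3 /\
             F (pt 1, pt (1 + qi)) = - ((gr_of d^-1%g : ZH) *: F edge3).
  by apply: symbol_translate edge3_unimodular _; rewrite /act_edge /= d_0 d_w.
have [E3 _] : F (pt wpt, pt (1 + qi)) = (gr_of c : ZH) *: F edge3 /\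
             F (pt (1 + qi), pt wpt) = - ((gr_of c : ZH) *: F edge3).
  by apply: symbol_translate edge3_unimodular _; rewrite /act_edge /= c_0 c_w.
rewrite (cycle_sum_eq (f := triF) E1 E3 E2).
move: (gr_of _) (gr_of c) (gr_of _) (F edge1) (F edge3) => g g' g'' x y.
by rewrite scalerDl addrA.
Qed.

End Symbol.

Lemma Mbd2_sum (V : lmodType ZH) (v : 'I_3 -> V) (v1 v2 v3 : V) :
    (forall r, v r = nth 0 [:: v1; v2; v3] r) ->
  [/\ \sum_(r < 3) Mbd2 a b c d r (@Ordinal 4 0 isT) *: v r =
        v1 + (1 - gr_of b : ZH) *: v2,
      \sum_(r < 3) Mbd2 a b c d r (@Ordinal 4 1 isT) *: v r =
        (gr_of a - 1 : ZH) *: v2 - (gr_of d^-1%g : ZH) *: v3,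
      \sum_(r < 3) Mbd2 a b c d r (@Ordinal 4 2 isT) *: v r =
        - ((1 + gr_of (c^-1 * a)%g : ZH) *: v1) + v3 &
      \sum_(r < 3) Mbd2 a b c d r (@Ordinal 4 3 isT) *: v r =
        (gr_of (c^-1 * a)%g : ZH) *: v1 + (gr_of c + gr_of d^-1%g : ZH) *: v3].
Proof.
exact (@boundary_mx_sum ZH V (gr_of a) (gr_of b) (gr_of c) (gr_of d^-1%g)
         (gr_of (c^-1 * a)%g) v v1 v2 v3).
Qed.
End Boundary.

(** * Generators of the Steinberg module *)

Lemma I3_ind (P : 'I_3 -> Prop) :
  P (@Ordinal 3 0 isT) -> P (@Ordinal 3 1 isT) -> P (@Ordinal 3 2 isT) ->
  forall r, P r.
Proof.
move=> P0 P1 P2 [[|[|[|//]]] p]; [move: P0|move: P1|move: P2];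
  congr (P _); exact/val_inj.
Qed.

Lemma I4_ind (P : 'I_4 -> Prop) :
  P (@Ordinal 4 0 isT) -> P (@Ordinal 4 1 isT) -> P (@Ordinal 4 2 isT) ->
  P (@Ordinal 4 3 isT) -> forall t, P t.
Proof.
move=> P0 P1 P2 P3 [[|[|[|[|//]]]] p]; [move: P0|move: P1|move: P2|move: P3];
  congr (P _); exact/val_inj.
Qed.

Lemma edge_symbolE (o : oedge) : edge_symbol (val o) = om_of orev_act o.
Proof. by rewrite /edge_symbol valK. Qed.

Lemma unimodular_oedge e : unimodular e -> exists o : oedge, e = val o.
Proof.
move=> eU; have eB : `[< unimodular e >] by apply/asboolP.
by exists (exist (fun e => `[< unimodular e >]) e eB).
Qed.

Lemma edge_symbol_act h e : unimodular e ->
  edge_symbol (act_edge h e) = (gr_of h : ZH) *: edge_symbol e.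
Proof.
move=> /unimodular_oedge[o ->]; rewrite edge_symbolE.
exact: etrans (edge_symbolE (gact h o)) (om_of_act orev_act h o).
Qed.

Lemma edge_symbol_rev e : unimodular e -> edge_symbol (e.2, e.1) = - edge_symbol e.
Proof.
move=> /unimodular_oedge[o ->]; rewrite edge_symbolE.
exact: etrans (edge_symbolE (orev o)) (om_of_rev orev_act o).
Qed.

Lemma val_StZ (x : ZH) (s : St) : val (x *: s) = x *: (val s : permMod cuspSet).
Proof. by []. Qed.
Lemma val_StD (s s' : St) : val (s + s') = val s + val s'. Proof. by []. Qed.
Lemma val_StN (s : St) : val (- s) = - val s. Proof. by []. Qed.
Lemma val_bd1 e : val (bd1 e) = pm_of (e.2 : cuspSet) - pm_of (e.1 : cuspSet).
Proof. by []. Qed.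

Lemma bd1_act h e : bd1 (act_edge h e) = (gr_of h : ZH) *: bd1 e.
Proof.
apply: val_inj; rewrite val_StZ !val_bd1 scalerBr.
exact (congr2 (fun x y : permMod cuspSet => x - y)
  (esym (pm_scaleU h (e.2 : cuspSet))) (esym (pm_scaleU h (e.1 : cuspSet)))).
Qed.

Lemma bd1_rev e : bd1 (e.2, e.1) = - bd1 e.
Proof. by apply: val_inj; rewrite val_StN !val_bd1 opprB. Qed.

Lemma bd1_cycle f : cycle_sum bd1 f = 0.
Proof.
apply: val_inj; case: f => -[al be] ga; rewrite /cycle_sum !val_StD !val_bd1.
move: (pm_of (al : cuspSet)) (pm_of (be : cuspSet)) (pm_of (ga : cuspSet)).
by move=> x y z; rewrite [y - x + _]addrC !subrKA subrr.
Qed.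

Lemma bd1_map_linear : linear bd1_map.
Proof.
move=> k x y; rewrite /bd1_map scaler_sumr -big_split; apply: eq_bigr => r _.
by rewrite !mxE scalerDl scalerA.
Qed.
HB.instance Definition _ :=
  GRing.isLinear.Build ZH 'rV[ZH]_3 St *:%R bd1_map bd1_map_linear.

Lemma bd1_mapD x y : bd1_map (x + y) = bd1_map x + bd1_map y.
Proof. exact: raddfD. Qed.
Lemma bd1_mapB x y : bd1_map (x - y) = bd1_map x - bd1_map y.
Proof. exact: raddfB. Qed.
Lemma bd1_mapN x : bd1_map (- x) = - bd1_map x.
Proof. exact: raddfN. Qed.
Lemma bd1_mapZ k x : bd1_map (k *: x) = k *: bd1_map x.
Proof. exact: linearZ. Qed.
Lemma bd1_map0 : bd1_map 0 = 0.
Proof. exact: raddf0. Qed.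

Lemma bd1_map_delta r : bd1_map (delta_mx 0 r) = bd1 (edge_rep r).
Proof.
rewrite /bd1_map (bigD1 r) //= mxE !eqxx scale1r big1 ?addr0 // => i ir.
by rewrite mxE (negbTE ir) andbF scale0r.
Qed.

Lemma bd1_map_edge e : unimodular e -> exists x, bd1_map x = bd1 e.
Proof.
move=> /edge_orbit[r [b [h ->]]].
pose x : 'rV[ZH]_3 := (gr_of h : ZH) *: delta_mx 0 r.
have xE : bd1_map x = bd1 (act_edge h (edge_rep r)).
  by rewrite bd1_act /x bd1_mapZ bd1_map_delta.
case: b; last by exists x.
exists (- x); rewrite bd1_mapN xE; symmetry.
exact: (bd1_rev (act_edge h (edge_rep r))).
Qed.

Lemma depth0_infty al : depth al = 0%N -> al = infty.
Proof.
have [x [y [lx px]]] := primitive_lift al.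
rewrite (depthE lx px) => /eqP; rewrite normZ_eq0 => /eqP y0; rewrite y0 in lx.
apply: (lifts_uniq lx); apply: lifts_infty; apply/eqP => x0.
by apply: (lifts_neq0 lx); rewrite x0.
Qed.

(** Follow the descent from the cusp down to infinity. *)
Lemma bd1_map_cusp (al : cuspSet) : exists x : 'rV[ZH]_3,
  val (bd1_map x) = pm_of al - pm_of (infty : cuspSet).
Proof.
have [n] := ubnP (depth al); elim: n al => // n IH al an.
have [d0|d0] := boolP (depth al == 0%N).
  exists 0; rewrite (depth0_infty (eqP d0)) subrr.
  exact: (congr1 val bd1_map0).
have [adj lt] := descendP d0.
have [x xE] := IH (descend al) (leq_trans lt an).
have [y yE] := bd1_map_edge adj.
exists (y + x); rewrite bd1_mapD val_StD xE yE val_bd1.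
move: (pm_of (al : cuspSet)) (pm_of (descend al : cuspSet)) (pm_of (infty : cuspSet)).
by move=> p q r; rewrite subrKA.
Qed.

(** A divisor m of degree zero is the sum of the differences of its points with
    infinity; for any m the same sum misses m by its degree at infinity. *)
Lemma bd1_map_surjective (s : St) : exists x : 'rV[ZH]_3, bd1_map x = s.
Proof.
have key (m : permMod cuspSet) : exists x : 'rV[ZH]_3,
    val (bd1_map x) = m - pm_of (infty : cuspSet) *~ degree m.
  elim/malg_Zind: m => [al|m m' [x xE] [x' xE']|].
  - by have [x xE] := bd1_map_cusp al; exists x; rewrite xE (degreeU al) mulr1z.
  - exists (x - x'); rewrite bd1_mapB val_StD val_StN xE xE' degreeB mulrzBr.
    move: (degree m) (degree m') (pm_of (infty : cuspSet)) => k k' p.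
    by rewrite !opprD !opprK !addrA [_ - _ - m']addrAC.
  - exists 0; rewrite bd1_map0.
    have -> : degree (0 : permMod cuspSet) = 0 by exact: raddf0.
    by rewrite mulr0z subr0.
have [x xE] := key (val s); exists x; apply: val_inj; rewrite xE.
have /eqP -> : degree (val s) == 0 := valP s.
by rewrite mulr0z subr0.
Qed.

(** * From equivariant cochains to modular symbols *)

(** The representative is unique as the orbits are distinct, the group element
    because stabilizers are trivial, and the orientation since the ends of an
    edge differ. *)
Lemma edge_orbit_unique r b h r' b' h' :
  act_edge h (flip_edge b (edge_rep r)) = act_edge h' (flip_edge b' (edge_rep r')) ->
  [/\ r = r', b = b' & h = h'].
Proof.
move=> E; have ES : translate h (edge_set (edge_rep r)) =
                    translate h' (edge_set (edge_rep r')).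
  have := congr1 edge_set E.
  by rewrite -!translate_edge (edge_set_flip b) (edge_set_flip b').
have rU : unoriented_edge (edge_set (edge_rep r)).
  by exists (edge_rep r); split; first exact: edge_rep_unimodular.
have rr : r = r'.
  have SU : unoriented_edge (translate h (edge_set (edge_rep r))).
    exists (act_edge h (edge_rep r)); split; last exact: translate_edge.
    exact/act_edge_unimodular/edge_rep_unimodular.
  have [i [_ iU]] := edge_orbits.2 _ SU.
  exact (etrans (esym (iU r (ex_intro _ h erefl))) (iU r' (ex_intro _ h' ES))).
subst r'; set S := edge_set _ in ES rU.
have translateM g g' : translate (g * g')%g S = translate g (translate g' S).
  by apply/fsetP => x; rewrite !mem_translate invgM gactM.
have translate1 : translate 1%g S = S.
  by apply/fsetP => x; rewrite mem_translate invg1 gact1.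
have hh : h = h'.
  apply: (mulgI h'^-1%g); rewrite mulVg; apply: (edge_stabilizers rU).
  by rewrite translateM ES -translateM mulVg translate1.
split=> //; move: E (edge_rep_unimodular r).
rewrite hh /act_edge; case: (edge_rep r) => al be + /adjacent_neq/negP.
have inj (x y z t : cusp) : (gact h' x, gact h' y) = (gact h' z, gact h' t) -> x = z.
  by move=> /(congr1 fst) /=; apply: gact_inj.
case: b b' => -[] //= /inj ab []; apply/eqP; last exact ab.
exact (esym ab).
Qed.

Lemma gr_ofM (h g : Gamma1) : gr_of (h * g)%g = gr_of h * gr_of g :> ZH.
Proof. by symmetry; apply: flift2U. Qed.

Section Cochain.
Variables (V : lmodType ZH) (v : 'I_3 -> V).

Definition signed (b : bool) (x : V) : V := if b then - x else x.

(** The equivariant antisymmetric function with value v r at the r-th edge; zero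
    on pairs of cusps that are no edges. *)
Definition cochain (e : cusp * cusp) : V :=
  if pselect (exists rbh : 'I_3 * bool * Gamma1,
      e = act_edge rbh.2 (flip_edge rbh.1.2 (edge_rep rbh.1.1))) is left ex
  then let: (r, b, h) := projT1 (cid ex) in signed b ((gr_of h : ZH) *: v r)
  else 0.

Lemma signedZ b (x : ZH) y : signed b (x *: y) = x *: signed b y.
Proof. by case: b => //=; rewrite scalerN. Qed.

Lemma cochainE r b h : cochain (act_edge h (flip_edge b (edge_rep r))) =
  signed b ((gr_of h : ZH) *: v r).
Proof.
rewrite /cochain; case: pselect => [ex|[]]; last by exists (r, b, h).
case: cid => -[[r' b'] h'] /= E.
by have [-> -> ->] := edge_orbit_unique E.
Qed.

Lemma cochain_act h e : unimodular e ->
  cochain (act_edge h e) = (gr_of h : ZH) *: cochain e.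
Proof.
move=> /edge_orbit[r [b [g ->]]]; rewrite -act_edgeM !cochainE.
have key : (gr_of (h * g)%g : ZH) *: v r = (gr_of h : ZH) *: ((gr_of g : ZH) *: v r).
  exact (etrans (congr1 (fun x : ZH => x *: v r) (gr_ofM h g))
                (esym (scalerA (gr_of h : ZH) (gr_of g : ZH) (v r)))).
exact (etrans (congr1 (signed b) key) (signedZ _ _ _)).
Qed.

Lemma cochain_rev e : unimodular e -> cochain (e.2, e.1) = - cochain e.
Proof.
move=> /edge_orbit[r [b [g ->]]].
have -> : ((act_edge g (flip_edge b (edge_rep r))).2,
           (act_edge g (flip_edge b (edge_rep r))).1) =
          act_edge g (flip_edge (~~ b) (edge_rep r)).
  by case: b; rewrite /act_edge //=; case: (edge_rep r).
by rewrite !cochainE; case: b; rewrite /= ?opprK.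
Qed.

Lemma act_edge1 e : act_edge 1%g e = e.
Proof. by case: e => al be; rewrite /act_edge !gact1. Qed.

Lemma cochain_rep r : cochain (edge_rep r) = v r.
Proof.
have := cochainE r false 1%g; rewrite act_edge1 => ->.
exact: scale1r.
Qed.

Lemma cycle_sum_act h f : ideal_triangle f ->
  cycle_sum cochain (act_tri h f) = (gr_of h : ZH) *: cycle_sum cochain f.
Proof.
case: f => -[al be] ga /ideal_adjacent[ab bc ca].
rewrite /cycle_sum !scalerDr -(cochain_act h ab) -(cochain_act h bc).
by rewrite -(cochain_act h ca).
Qed.

Lemma cycle_sum_rotate f : cycle_sum cochain (rotate_tri f) = cycle_sum cochain f.
Proof. by rewrite /cycle_sum /= addrC addrA. Qed.

Lemma cycle_sum_flip b f : ideal_triangle f ->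
  cycle_sum cochain (flip_tri b f) = signed b (cycle_sum cochain f).
Proof.
case: b => //; case: f => -[al be] ga /ideal_adjacent[ab bc ca].
rewrite /cycle_sum /= (cochain_rev ab) (cochain_rev bc) (cochain_rev ca).
by rewrite !opprD addrAC.
Qed.

Lemma signed0 b : signed b 0 = 0 :> V. Proof. by case: b; rewrite /= ?oppr0. Qed.

Section Extension.
Hypothesis cycle_rep : forall t, cycle_sum cochain (tri_rep t) = 0.

Lemma cochain_cocycle f : ideal_triangle f -> cycle_sum cochain f = 0.
Proof.
move=> /tri_orbit[t [b [k [h ->]]]].
have T : ideal_triangle (iter k rotate_tri (flip_tri b (tri_rep t))).
  have : tri_lifts (iter k rotate_tri (flip_tri b (tri_rep t)))
    (iter k rotate_basis (flip_basis b (tri_basis t))).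
    elim: k => [|k IH] /=; last exact: rotate_lifts.
    exact/flip_tri_lifts/tri_basisP.
  exact: tri_lifts_ideal.
rewrite (cycle_sum_act h T).
have -> : cycle_sum cochain (iter k rotate_tri (flip_tri b (tri_rep t))) = 0.
  elim: k {T} => [|k IH]; last by rewrite iterS cycle_sum_rotate.
  by rewrite (cycle_sum_flip b (tri_rep_ideal t)) cycle_rep signed0.
by rewrite scaler0.
Qed.

Let E al be := cochain (al, be).
Let P : cusp -> V := potential E.

Lemma potential_edge e : unimodular e -> P e.2 - P e.1 = cochain e.
Proof.
case: e => al be ab; apply: (@potentialP V E) ab => [x y xy|x y z T].
  exact: (cochain_rev xy).
exact: (cochain_cocycle T).
Qed.

(** A divisor of degree zero is evaluated by summing the potential over its
    points. *)
Definition symbol_of (s : St) : V := flift P (val s).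

Lemma symbol_ofB s s' : symbol_of (s - s') = symbol_of s - symbol_of s'.
Proof. exact: raddfB. Qed.

Lemma symbol_of_edge e : unimodular e -> symbol_of (bd1 e) = cochain e.
Proof.
move=> eU; rewrite -(potential_edge eU) /symbol_of val_bd1.
exact: etrans (raddfB _ _ _) (congr2 (fun x y => x - y) (fliftU _ _) (fliftU _ _)).
Qed.

Lemma symbol_of_scale (x : ZH) r :
  symbol_of (x *: bd1 (edge_rep r)) = x *: v r.
Proof.
elim/malg_Zind: x => [h|x y IHx IHy|].
- transitivity (symbol_of (bd1 (act_edge h (edge_rep r)))).
    by rewrite bd1_act.
  rewrite symbol_of_edge; last exact/act_edge_unimodular/edge_rep_unimodular.
  by rewrite (cochain_act h (edge_rep_unimodular r)) cochain_rep.
- by rewrite !scalerBl symbol_ofB IHx IHy.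
- by rewrite !scale0r /symbol_of; apply: raddf0.
Qed.

(** Linearity over the group ring is checked on the generators of the Steinberg
    module; this formula, together with [bd1_map_surjective], makes it explicit. *)
Lemma symbol_ofE (x : 'rV[ZH]_3) : symbol_of (bd1_map x) = \sum_r x 0 r *: v r.
Proof.
have symD s s' : symbol_of (s + s') = symbol_of s + symbol_of s' by exact: raddfD.
rewrite /bd1_map (big_morph _ symD (raddf0 _ : symbol_of 0 = 0)).
by apply: eq_bigr => r _; apply: symbol_of_scale.
Qed.

Lemma symbol_of_linear : linear symbol_of.
Proof.
move=> k s s'; have [x <-] := bd1_map_surjective s; have [y <-] := bd1_map_surjective s'.
rewrite -bd1_mapZ -bd1_mapD !symbol_ofE scaler_sumr -big_split.
by apply: eq_bigr => r _; rewrite !mxE scalerDl scalerA.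
Qed.
HB.instance Definition _ :=
  GRing.isLinear.Build ZH St V *:%R symbol_of symbol_of_linear.

Lemma symbol_exists : exists phi : Symb V, forall r, phi (bd1 (edge_rep r)) = v r.
Proof.
exists symbol_of => r /=.
by rewrite (symbol_of_edge (edge_rep_unimodular r)) cochain_rep.
Qed.
End Extension.
End Cochain.

(** * Exactness and the kernel of delta *)

Definition image_pred (M : 'M[ZH]_(3, 4)) : {pred 'rV[ZH]_3} :=
  fun x => `[< exists y, x = left_map M y >].

Fact image_zmod_closed M : zmod_closed (image_pred M).
Proof.
split=> [|x x' /asboolP[y ->] /asboolP[y' ->]]; apply/asboolP.
  by exists 0; rewrite /left_map mul0mx.
by exists (y - y'); rewrite /left_map mulmxBl.
Qed.
HB.instance Definition _ M :=
  GRing.isZmodClosed.Build 'rV[ZH]_3 (image_pred M) (image_zmod_closed M).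

Lemma image_scale M (k : ZH) x : x \in image_pred M -> k *: x \in image_pred M.
Proof.
by move=> /asboolP[y ->]; apply/asboolP; exists (k *: y); rewrite /left_map scalemxAl.
Qed.

Lemma left_map_delta (M : 'M[ZH]_(3, 4)) t r : left_map M (delta_mx 0 t) 0 r = M r t.
Proof. by rewrite /left_map -rowE !mxE. Qed.

Section Exactness.
Variables a b c d : Gamma1.
Hypothesis aE : is_class_of (val a) (mx2 1 zi 0 1).
Hypothesis bE : is_class_of (val b) (mx2 1 (- 1) 0 1).
Hypothesis cE : is_class_of (val c) (mx2 (- 2%:R * zi) zi (- 2%:R - zi) (1 + zi)).
Hypothesis dE : is_class_of (val d)
  (mx2 (- 1) (1 + zi) (- 1 + 2%:R * zi) (2%:R - zi)).
Let M := Mbd2 a b c d.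

(** The columns of the matrix are the boundaries of the four triangles. *)
Lemma cycle_sum_rep (V : lmodType ZH) (F : cusp * cusp -> V) :
    (forall h e, unimodular e -> F (act_edge h e) = (gr_of h : ZH) *: F e) ->
    (forall e, unimodular e -> F (e.2, e.1) = - F e) ->
  forall t, cycle_sum F (tri_rep t) = \sum_(r < 3) M r t *: F (edge_rep r).
Proof.
move=> F_act F_rev.
have vE r : F (edge_rep r) = nth 0 [:: F edge1; F edge2; F edge3] r.
  by move: r; apply: I3_ind.
have [EA EB EE EF] := Mbd2_sum a b c d vE.
apply: I4_ind.
- exact (etrans (cycle_sumA bE F_act F_rev) (esym EA)).
- exact (etrans (cycle_sumB aE dE F_act F_rev) (esym EB)).
- exact (etrans (cycle_sumE aE cE F_act F_rev) (esym EE)).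
- exact (etrans (cycle_sumF aE cE dE F_act F_rev) (esym EF)).
Qed.

Lemma symbol_of_relations (V : lmodType ZH) (v : 'I_3 -> V) :
    (forall t, \sum_(r < 3) M r t *: v r = 0) ->
  exists phi : Symb V, forall r, phi (bd1 (edge_rep r)) = v r.
Proof.
move=> rel; apply: symbol_exists => t.
rewrite (cycle_sum_rep (@cochain_act V v) (@cochain_rev V v)) -[RHS](rel t).
by apply: eq_bigr => r _; rewrite cochain_rep.
Qed.

Lemma bd1_relation t : \sum_(r < 3) M r t *: bd1 (edge_rep r) = 0.
Proof.
rewrite -(cycle_sum_rep (fun h e _ => bd1_act h e) (fun e _ => bd1_rev e)).
exact: bd1_cycle.
Qed.

Lemma bd1_left_map y : bd1_map (left_map M y) = 0.
Proof.
rewrite [y]row_sum_delta /left_map mulmx_suml.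
rewrite (big_morph bd1_map bd1_mapD bd1_map0) big1 // => t _.
rewrite -scalemxAl bd1_mapZ; apply: (etrans (congr1 _ _) (scaler0 _ _)).
rewrite -[RHS](bd1_relation t); apply: eq_bigr => r _.
by rewrite -[_ *m _]/(left_map M (delta_mx 0 t)) left_map_delta.
Qed.

(** Map the Steinberg module to the cokernel of the boundary matrix by a symbol
    whose value at the r-th edge is the class of the r-th basis vector.  Composed
    with the map from the free module it is the projection to the cokernel, so
    the kernel of that map is contained in the image of the matrix. *)
Lemma bd1_exact x : bd1_map x = 0 -> exists y, x = left_map M y.
Proof.
move=> x0; pose pi := quot_pi (@image_scale M).
have rel t : \sum_(r < 3) M r t *: pi (delta_mx 0 r) = 0.
  have -> : \sum_(r < 3) M r t *: pi (delta_mx 0 r) = pi (left_map M (delta_mx 0 t)).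
    rewrite [left_map _ _]row_sum_delta /pi linear_sum; apply: eq_bigr => r _.
    by rewrite left_map_delta linearZ.
  by apply/eqP; rewrite quot_pi_eq0; apply/asboolP; exists (delta_mx 0 t).
have [phi phiE] := symbol_of_relations rel.
have : pi x = phi (bd1_map x).
  rewrite /bd1_map linear_sum [x in LHS]row_sum_delta /pi linear_sum.
  by apply: eq_bigr => r _; rewrite !linearZ phiE.
by rewrite x0 linear0 => /eqP; rewrite quot_pi_eq0 => /asboolP.
Qed.

Lemma deltaH_eq0 (V : lmodType ZH) (v1 v2 v3 : V) :
  deltaH a b c d (v1, v2, v3) = 0 <->
  forall t, \sum_(r < 3) M r t *: nth 0 [:: v1; v2; v3] r = 0.
Proof.
have [EA EB EE EF] := Mbd2_sum a b c d (fun r => erefl (nth 0 [:: v1; v2; v3] r)).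
have E : deltaH a b c d (v1, v2, v3) =
  (\sum_(r < 3) M r (@Ordinal 4 0 isT) *: nth 0 [:: v1; v2; v3] r,
   \sum_(r < 3) M r (@Ordinal 4 1 isT) *: nth 0 [:: v1; v2; v3] r,
   \sum_(r < 3) M r (@Ordinal 4 2 isT) *: nth 0 [:: v1; v2; v3] r,
   \sum_(r < 3) M r (@Ordinal 4 3 isT) *: nth 0 [:: v1; v2; v3] r).
  rewrite EA EB EE EF /deltaH; clear.
  move: (gr_of a : ZH) (gr_of b : ZH) (gr_of c : ZH) (gr_of d^-1%g : ZH)
    (gr_of (c^-1 * a)%g : ZH) => g1 g2 g3 g4 g5.
  by rewrite !scalerBl !scalerDl !scale1r opprD !addrA.
split=> [E0|E0]; last by rewrite E !E0.
move: E0; rewrite E => -[E1 E2 E3 E4].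
exact: I4_ind.
Qed.

Lemma symb_bd1 (V : lmodType ZH) (phi : Symb V) x :
  phi (bd1_map x) = \sum_r x 0 r *: phi (bd1 (edge_rep r)).
Proof. by rewrite linear_sum; apply: eq_bigr => r _; rewrite linearZ. Qed.

(** The three edges generate the Steinberg module. *)
Lemma symb_determined (V : lmodType ZH) (phi psi : Symb V) :
  symb_eval phi = symb_eval psi -> phi =1 psi.
Proof.
move=> [E1 E2 E3] s; have [x <-] := bd1_map_surjective s.
rewrite !symb_bd1; apply: eq_bigr => r _; congr (_ *: _).
by move: r; apply: I3_ind.
Qed.

Lemma symb_kernel (V : lmodType ZH) (v : V * V * V) :
  deltaH a b c d v = 0 <-> exists phi : Symb V, symb_eval phi = v.
Proof.
case: v => -[v1 v2] v3; rewrite deltaH_eq0; split=> [rel|[phi E] t].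
  have [phi phiE] := symbol_of_relations rel; exists phi.
  exact (congr2 pair (congr2 pair (phiE (@Ordinal 3 0 isT)) (phiE (@Ordinal 3 1 isT)))
     (phiE (@Ordinal 3 2 isT))).
have E' r : phi (bd1 (edge_rep r)) = nth 0 [:: v1; v2; v3] r.
  by case: E => <- <- <-; move: r; apply: I3_ind.
rewrite -[RHS](linear0 phi) -(bd1_relation t) linear_sum.
by apply: eq_bigr => r _; rewrite linearZ E'.
Qed.
End Exactness.

Theorem mainTheorem4 :
  exists a b c d : Gamma1,
    [/\ is_class_of (val a) (mx2 1 zi 0 1),
        is_class_of (val b) (mx2 1 (- 1) 0 1),
        is_class_of (val c) (mx2 (- 2%:R * zi) zi (- 2%:R - zi) (1 + zi)) &
        is_class_of (val d)
          (mx2 (- 1) (1 + zi) (- 1 + 2%:R * zi) (2%:R - zi))] /\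
    [/\ orbit_representatives unoriented_edge
          (fun r : 'I_3 => edge_set (edge_rep r)),
        orbit_representatives unoriented_triangle
          (fun t : 'I_4 => triangle_set (tri_rep t)),
        trivial_stabilizers unoriented_edge &
        trivial_stabilizers unoriented_triangle] /\
    (let e1 := edge_symbol edge1 in
     let e2 := edge_symbol edge2 in
     let e3 := edge_symbol edge3 in
     [/\ bd2 triA = e1 + (1 - gr_of b : ZH) *: e2,
         bd2 triB = (gr_of a - 1 : ZH) *: e2 - (gr_of d^-1%g : ZH) *: e3,
         bd2 triE = - ((1 + gr_of (c^-1 * a)%g : ZH) *: e1) + e3 &
         bd2 triF = (gr_of (c^-1 * a)%g : ZH) *: e1
                    + (gr_of c + gr_of d^-1%g : ZH) *: e3]) /\
    (forall t : 'I_4,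
       bd2 (tri_rep t) =
         \sum_(r < 3) Mbd2 a b c d r t *: edge_symbol (edge_rep r)) /\
    ((forall x : 'rV[ZH]_3,
        bd1_map x = 0 <-> exists y : 'rV[ZH]_4, x = left_map (Mbd2 a b c d) y) /\
     (forall s : St, exists x : 'rV[ZH]_3, bd1_map x = s)) /\
    (forall V : lmodType ZH,
       [/\ forall phi psi : Symb V,
             symb_eval (phi \+ psi) = symb_eval phi + symb_eval psi,
           forall phi psi : Symb V,
             symb_eval phi = symb_eval psi -> phi =1 psi &
           forall v : V * V * V,
             deltaH a b c d v = 0 <-> exists phi : Symb V, symb_eval phi = v]).
Proof.
have [a aE] : exists a : Gamma1, is_class_of (val a) (mx2 1 zi 0 1).
  by apply: (gamma1_exists (e := 1)) => //; apply/eqP; vm_compute.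
have [b bE] : exists b : Gamma1, is_class_of (val b) (mx2 1 (- 1) 0 1).
  by apply: (gamma1_exists (e := 1)) => //; apply/eqP; vm_compute.
have [c cE] : exists c : Gamma1,
    is_class_of (val c) (mx2 (- 2%:R * zi) zi (- 2%:R - zi) (1 + zi)).
  by apply: (gamma1_exists (e := -1)) => //; apply/eqP; vm_compute.
have [d dE] : exists d : Gamma1, is_class_of (val d)
    (mx2 (- 1) (1 + zi) (- 1 + 2%:R * zi) (2%:R - zi)).
  by apply: (gamma1_exists (e := -1)) => //; apply/eqP; vm_compute.
exists a, b, c, d; split; first by split.
split; first by split; [exact: edge_orbits|exact: tri_orbits|
  exact: edge_stabilizers|exact: triangle_stabilizers].
split.
  split.
  - exact (cycle_sumA bE edge_symbol_act edge_symbol_rev).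
  - exact (cycle_sumB aE dE edge_symbol_act edge_symbol_rev).
  - exact (cycle_sumE aE cE edge_symbol_act edge_symbol_rev).
  - exact (cycle_sumF aE cE dE edge_symbol_act edge_symbol_rev).
split; first exact (cycle_sum_rep aE bE cE dE edge_symbol_act edge_symbol_rev).
split; first split.
- move=> x; split=> [|[y ->]]; first exact (@bd1_exact _ _ _ _ aE bE cE dE x).
  exact (bd1_left_map aE bE cE dE y).
- exact bd1_map_surjective.
move=> V; split.
- by [].
- exact (@symb_determined V).
- exact (@symb_kernel _ _ _ _ aE bE cE dE V).
Qed.
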